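(* Let $U\ge 1$ be an integer, $p\in[0,1]$, and let $(w_i)_{i\ge 0}$ be a sequence of positive real numbers with $\liminf_{i\to\infty} w_{i+1}/w_i>1$. Consider the Interacting Urn Mechanism with $U$ urns, two colors (black and white), reinforcement weight sequence $(w_i)_{i\ge0}$ and interaction parameter $p$. (1) If $p\ge 1/2$, then almost surely all the urns eventually fixate on the same color: almost surely there exist a (random) color $\mathfrak{c}$ and a (random) finite time $n_0$ such that for all $n\ge n_0$ and all urns $u$, the ball added to urn $u$ at time $n$ has color $\mathfrak{c}$. (2) If $p<1/2$, then almost surely there exist a (random) color $\mathfrak{c}$, a (random) finite time $n_0$, and a (random) nonempty set of urns $S\subseteq\{1,\dots,U\}$ such that: for every $u\in S$ and every $n\ge n_0$, the ball added to urn $u$ at time $n$ has color $\mathfrak{c}$; and for every $u\notin S$ and every $n\ge n_0$, the ball added to urn $u$ at time $n$ has color $\mathfrak{c}$ if $X_n^u=1$ (the drawing is made from all the urns combined) and has the other color if $X_n^u=-1$ (the drawing is made from urn $u$ alone).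
   Context: Interacting Urn Mechanism. There are $U$ urns labelled $1,\dots,U$, all empty at time $0$; at each time $n\ge1$ exactly one ball, black or white, is added to each urn. For integers $i,j\ge0$ put $\pi(i,j)=\frac{w_i}{w_i+w_j}$. Let $(X_n^u)_{n\ge1,\,1\le u\le U}$ be i.i.d. with $\mathbb{P}[X_n^u=1]=1-\mathbb{P}[X_n^u=-1]=p$, and let $(V_n^u)_{n\ge1,\,1\le u\le U}$ be i.i.d. uniform on $[0,1]$, independent of the $X_n^u$. Let $B_n^u$ and $W_n^u=n-B_n^u$ be the numbers of black and white balls in urn $u$ at time $n$, and $B_n^*=\sum_u B_n^u$, $W_n^*=\sum_u W_n^u$. At time $n\ge1$, simultaneously for every urn $u$: if $X_n^u=1$ (drawing from all the urns combined), the ball added to urn $u$ is black if $V_n^u<\pi(B_{n-1}^*,W_{n-1}^* )$ and white otherwise; if $X_n^u=-1$ (drawing from urn $u$ alone), the ball added to urn $u$ is black if $V_n^u<\pi(B_{n-1}^u,W_{n-1}^u)$ and white otherwise. *)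

(* Defs.v *)
From HB Require Import structures.
From mathcomp Require Import all_boot all_order all_algebra finmap.
From mathcomp Require Import all_classical all_reals all_analysis.

Set Implicit Arguments.
Unset Strict Implicit.
Unset Printing Implicit Defensive.

Import Order.TTheory GRing.Theory Num.Theory.

Local Open Scope classical_set_scope.
Local Open Scope ring_scope.

Definition mutually_independent (d : measure_display) (T : measurableType d)
    (R : realType) (P : probability T R) (I : choiceType) (D : set I)
    (X : I -> {RV P >-> R}) : Prop :=
  forall (A : {fset I}) (B : I -> set R),
    [set` A] `<=` D -> (forall i, measurable (B i)) ->
    P (\bigcap_(i in [set` A]) X i @^-1` B i) =
      (\prod_(i <- A) P (X i @^-1` B i))%E.

Definition sigma_family (d : measure_display) (T : measurableType d)
    (R : realType) (P : probability T R) (I : Type) (D : set I)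
    (X : I -> {RV P >-> R}) : set (set T) :=
  <<s \bigcup_(i in D) preimage_set_system setT (X i) measurable >>.

Definition independent_families (d : measure_display) (T : measurableType d)
    (R : realType) (P : probability T R) (I J : Type) (D : set I) (E : set J)
    (X : I -> {RV P >-> R}) (Y : J -> {RV P >-> R}) : Prop :=
  forall A B : set T, sigma_family D X A -> sigma_family E Y B ->
    P (A `&` B) = (P A * P B)%E.

(* Colors are booleans: true is black, false is white, ~~ c is the color other
   than c. *)
Definition color := bool.

Definition reinf_prob (R : realType) (w : nat -> R) (i j : nat) : R :=
  w i / (w i + w j).

(* Color of the ball added to urn u when, before the step, urn k contains b k
   black and c k white balls, x k is the sign deciding where urn k draws from
   and v k is its uniform variable.  The sign only takes the values 1 and -1
   (almost surely), so the else branch is the case x u = -1. *)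
Definition draw (R : realType) (U : nat) (w : nat -> R) (x v : 'I_U -> R)
    (b c : 'I_U -> nat) (u : 'I_U) : color :=
  if x u == 1
  then v u < reinf_prob w (\sum_(k < U) b k)%N (\sum_(k < U) c k)%N
  else v u < reinf_prob w (b u) (c u).

(* Number of black balls in urn u at time n; the number of white balls is
   n - blacks n u.  The values x 0 and v 0 are never used. *)
Fixpoint blacks (R : realType) (U : nat) (w : nat -> R)
    (x v : nat -> 'I_U -> R) (n : nat) : 'I_U -> nat :=
  if n is m.+1 then
    let b := blacks w x v m in
    fun u => (b u + draw w (x m.+1) (v m.+1) b (fun k => m - b k) u)%N
  else fun=> 0%N.

(* Color of the ball added to urn u at time n; meaningful for n >= 1. *)
Definition ball_added (R : realType) (U : nat) (w : nat -> R)
    (x v : nat -> 'I_U -> R) (n : nat) (u : 'I_U) : color :=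
  let b := blacks w x v n.-1 in
  draw w (x n) (v n) b (fun k => n.-1 - b k)%N u.

(* Main.v *)
(* Recording, for every step and urn, whether the draw is combined and the color of
   the ball, turns the mechanism into a chain of finite outcomes whose path
   probabilities are explicit products.  If the conditional probability of eventual
   fixation given any finite history is bounded below by a constant, fixation is
   almost sure, because the fixation event is approximated by events depending on
   finitely many steps.

   For the lower bound, call the lead of a pot the difference between its two colors.
   The minority color is drawn with probability O(lead^-3), and as long as no
   minority ball is drawn a lead Q with positive drift makes 1/Q a supermartingale
   with a gain of order Q^-2.  Hence a configuration all of whose leads are large and
   drift outwards survives forever with probability at least 7/8, and finitely many
   forced steps make leads large at a constant price.  A lead whose drift is only
   nonnegative, possibly zero, reaches 0 from any negative value with probability
   bounded below, by comparison with a quadratic submartingale.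

   - If p >= 1/2, the combined pot and one urn are first captured by the majority
     color; the lead of any other urn then has drift at least 2p - 1 >= 0, so the
     urns are captured one after the other.
   - If p < 1/2, every urn drifts away from 0 on its own.  If S is the set of urns
     dominated by c, the combined lead of c has drift m(S) while c dominates the
     combined pot, and m(S) + m(~S) = 2pU.  Either m(S) > 0 for the current
     combined majority color, which is captured, or the combined lead of the other
     color has nonnegative drift and climbs back to 0. *)

Require Import Defs.
From HB Require Import structures.
From mathcomp Require Import all_boot all_order all_algebra finmap.
From mathcomp Require Import all_classical all_reals all_analysis.
From mathcomp Require Import ring lra zify.

Set Implicit Arguments.
Unset Strict Implicit.
Unset Printing Implicit Defensive.

Import Order.TTheory GRing.Theory Num.Theory.
Import numFieldNormedType.Exports.

Local Open Scope classical_set_scope.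
Local Open Scope ring_scope.

(** * Outcomes and their transition probabilities *)

Section kernel.
Context (R : realType) (U : nat) (p : R) (w : nat -> R).
Hypotheses (p_ge0 : 0 <= p) (p_le1 : p <= 1).
Hypothesis w_gt0 : forall i, 0 < w i.

(** The first component of an entry is true for a combined draw; the second is the color of the
    ball, true for black. *)
Definition outcome := {ffun 'I_U -> bool * bool}.

(* A pot is either the union of all the urns, [None], or a single urn. *)
Definition pot := option 'I_U.

Definition source (x : bool) (u : 'I_U) : pot := if x then None else Some u.

Definition content (a : bool) (s : seq outcome) (i : pot) : nat :=
  if i is Some u then count (fun o : outcome => (o u).2 == a) s
  else (\sum_(u < U) count (fun o : outcome => (o u).2 == a) s)%N.

(** Given the history, the urns act independently, so one step has as law the product [kern] of the
    laws [kern1]. *)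
Definition kern1 (s : seq outcome) (u : 'I_U) (e : bool * bool) : R :=
  (if e.1 then p else 1 - p) *
  reinf_prob w (content e.2 s (source e.1 u)) (content (~~ e.2) s (source e.1 u)).

Definition kern (s : seq outcome) (o : outcome) : R := \prod_(u < U) kern1 s u (o u).

Lemma reinf_probC i j : reinf_prob w i j + reinf_prob w j i = 1.
Proof.
rewrite /reinf_prob [w j + w i]addrC -mulrDl divff //.
by rewrite gt_eqF // addr_gt0.
Qed.

Lemma reinf_prob_gt0 i j : 0 < reinf_prob w i j.
Proof. by rewrite divr_gt0 // addr_gt0. Qed.

Lemma reinf_prob_le1 i j : reinf_prob w i j <= 1.
Proof. by rewrite -(reinf_probC i j) lerDl ltW // reinf_prob_gt0. Qed.

Lemma kern1_ge0 s u e : 0 <= kern1 s u e.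
Proof.
rewrite mulr_ge0 ?(ltW (reinf_prob_gt0 _ _)) //.
by case: ifP => _ //; rewrite subr_ge0.
Qed.

Lemma sum_bool2 (F : bool * bool -> R) :
  \sum_e F e = (F (true, true) + F (true, false)) + (F (false, true) + F (false, false)).
Proof.
transitivity (\sum_a \sum_b F (a, b)).
  by rewrite pair_big; apply: eq_bigr => -[].
by rewrite !big_bool.
Qed.

Lemma sum_kern1_x s u (g : bool -> R) :
  \sum_e kern1 s u e * g e.1 = p * g true + (1 - p) * g false.
Proof.
rewrite sum_bool2 /kern1 /=.
rewrite -[p * g true]mulr1 -[X in _ = _ * X + _](reinf_probC
  (content true s None) (content false s None)).
rewrite -[(1 - p) * g false]mulr1.
rewrite -[X in _ = _ + _ * X](reinf_probC
  (content true s (Some u)) (content false s (Some u))).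
by rewrite !mulrDr /=; congr (_ + _ + (_ + _)); rewrite mulrAC.
Qed.

Lemma sum_kern1 s u : \sum_e kern1 s u e = 1.
Proof.
transitivity (\sum_e kern1 s u e * 1); first by apply: eq_bigr => e _; rewrite mulr1.
by rewrite (sum_kern1_x s u (fun=> 1)); ring.
Qed.

Lemma kern_ge0 s o : 0 <= kern s o.
Proof. by apply: prodr_ge0 => u _; exact: kern1_ge0. Qed.

Lemma sum_kern_prod s (g : 'I_U -> bool * bool -> R) :
  \sum_o kern s o * \prod_u g u (o u) = \prod_u \sum_e kern1 s u e * g u e.
Proof.
by rewrite bigA_distr_bigA; apply: eq_bigr => o _; rewrite -big_split.
Qed.

Lemma sum_kern s : \sum_o kern s o = 1.
Proof.
transitivity (\sum_o kern s o * \prod_(u < U) 1).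
  by apply: eq_bigr => o _; rewrite big1 ?mulr1.
rewrite (sum_kern_prod s (fun _ _ => 1)) big1 // => u _.
by under eq_bigr do rewrite mulr1; rewrite sum_kern1.
Qed.

Lemma sum_kern_urn s u (g : bool * bool -> R) :
  \sum_o kern s o * g (o u) = \sum_e kern1 s u e * g e.
Proof.
transitivity (\sum_o kern s o * \prod_v (if v == u then g (o v) else 1)).
  apply: eq_bigr => o _; rewrite (bigD1 u) //= eqxx big1 ?mulr1 //.
  by move=> v /negPf ->.
rewrite (sum_kern_prod s (fun v e => if v == u then g e else 1)).
rewrite (bigD1 u) //= eqxx [X in _ * X]big1 ?mulr1 // => v /negPf ->.
by under eq_bigr do rewrite mulr1; rewrite sum_kern1.
Qed.

Lemma sum_kern_x s u (g : bool -> R) :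
  \sum_o kern s o * g (o u).1 = p * g true + (1 - p) * g false.
Proof. by rewrite (sum_kern_urn s u (fun e => g e.1)) sum_kern1_x. Qed.

Definition mean (step : 'I_U -> bool -> R) : R :=
  \sum_u (p * step u true + (1 - p) * step u false).

Definition total_step (step : 'I_U -> bool -> R) (o : outcome) : R :=
  \sum_u step u (o u).1.

Lemma sum_kern_total_step s step :
  \sum_o kern s o * total_step step o = mean step.
Proof.
under eq_bigr do rewrite mulr_sumr.
by rewrite exchange_big; apply: eq_bigr => u _; rewrite sum_kern_x.
Qed.

Lemma total_step_norm step o : (forall u x, `|step u x| <= 1) ->
  `|total_step step o| <= U%:R.
Proof.
move=> h; apply: le_trans (ler_norm_sum _ _ _) _.
apply: le_trans (ler_sum _ _) _; first by move=> u _; exact: h.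
by rewrite sumr_const card_ord.
Qed.

Definition lead (a : bool) (s : seq outcome) (i : pot) : R :=
  (content a s i)%:R - (content (~~ a) s i)%:R.

Definition sgc (b a : bool) : R := if b == a then 1 else -1.

Definition dlead (a : bool) (o : outcome) (i : pot) : R :=
  if i is Some u then sgc (o u).2 a else \sum_u sgc (o u).2 a.

Lemma leadN a s i : lead (~~ a) s i = - lead a s i.
Proof. by rewrite /lead negbK opprB. Qed.

Lemma lead_sum a s : lead a s None = \sum_u lead a s (Some u).
Proof. by rewrite /lead /= !natr_sum -sumrB. Qed.

Lemma lead_rcons a s o i : lead a (rcons s o) i = lead a s i + dlead a o i.
Proof.
have urn u : lead a (rcons s o) (Some u) = lead a s (Some u) + sgc (o u).2 a.
  rewrite /lead /content /sgc -!cats1 !count_cat /= !addn0 !natrD.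
  by case: a; case: (o u).2 => /=; ring.
case: i => [u|] //=; rewrite !lead_sum -big_split /=.
by apply: eq_bigr => u _; rewrite urn.
Qed.

End kernel.

Arguments lead {R U} a s i.
Arguments dlead {R U} a o i.
Arguments content {U} a s i.

(** * Leads with positive drift *)

Section drift.
Context (R : realType) (U : nat) (p : R) (w : nat -> R) (C : R).
Hypotheses (p_ge0 : 0 <= p) (p_le1 : p <= 1).
Hypothesis w_gt0 : forall i, 0 < w i.
Hypothesis w_growth : forall i j, (j <= i)%N ->
  w j * (i - j).+1%:R ^+ 3 <= C * w i.

Local Notation kern := (@kern R U p w).
Local Notation lead := (@lead R U).

Lemma growth_const_ge1 : 1 <= C.
Proof.
have := w_growth (leqnn 0).
by rewrite subnn expr1n mulr1 -[X in X <= _ -> _]mul1r ler_pM2r.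
Qed.

Lemma lead_le a (s : seq (outcome U)) i : 0 <= lead a s i ->
  (content (~~ a) s i <= content a s i)%N /\
  lead a s i = (content a s i - content (~~ a) s i)%N%:R.
Proof.
rewrite /lead subr_ge0 ler_nat => h; split=> //.
by rewrite natrB.
Qed.

Lemma minority_prob a (s : seq (outcome U)) i : 0 < lead a s i ->
  reinf_prob w (content (~~ a) s i) (content a s i) <= C / lead a s i ^+ 3.
Proof.
move=> lead_gt0; have [] := lead_le (ltW lead_gt0); move: lead_gt0.
move: (lead a s i) (content a s i) (content (~~ a) s i) => l i' j + le_n E.
rewrite {}E.
have := w_growth le_n; set d := (i' - j)%N => h d_gt0.
rewrite /reinf_prob ler_pdivrMr ?addr_gt0 // mulrAC ler_pdivlMr ?exprn_gt0 //.
apply: le_trans (_ : C * w i' <= _); last first.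
  rewrite ler_pM2l ?lerDr ?ltW //; exact: lt_le_trans ltr01 growth_const_ge1.
apply: le_trans h; rewrite ler_pM2l // lerXn2r ?nnegrE ?ler0n //.
by rewrite ler_nat.
Qed.

(** The minority weight is at most [C] times the majority weight; this fixes the price of a forced
    draw, uniformly in the history. *)
Lemma majority_prob a (s : seq (outcome U)) i : 0 <= lead a s i ->
  (1 + C)^-1 <= reinf_prob w (content a s i) (content (~~ a) s i).
Proof.
move=> /lead_le[le_n _]; have := w_growth le_n.
move: (content a s i) (content (~~ a) s i) le_n => i' j le_n h.
have C1 := growth_const_ge1.
have wj : w j <= C * w i'.
  apply: le_trans h; rewrite ler_peMr ?(ltW (w_gt0 j)) //.
  by rewrite exprn_ege1 // ler1n.
rewrite /reinf_prob -[leLHS]mul1r ler_pdivrMr; last by lra.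
rewrite mulrAC ler_pdivlMr ?addr_gt0 // mul1r mulrDr mulr1 lerD2l.
by rewrite mulrC.
Qed.

(** Backward recursion for the conditional probability, given [s], that the next [n] outcomes pass
    [ok]; [Pr_obeying_cyl] links it to the actual mechanism. *)
Fixpoint surv (ok : pred (outcome U)) (n : nat) (s : seq (outcome U)) : R :=
  if n is n'.+1
  then \sum_o kern s o * ((ok o)%:R * surv ok n' (rcons s o)) else 1.

Lemma surv_ge0 ok n s : 0 <= surv ok n s.
Proof.
elim: n s => [//|n IHn] s /=; apply: sumr_ge0 => o _.
by rewrite mulr_ge0 ?kern_ge0 // mulr_ge0.
Qed.

(** [v] stands for the conditional probability [settle_prob] of settling; at this point it is only
    known to be nonnegative and superharmonic. *)
Variable v : seq (outcome U) -> R.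
Hypothesis v_ge0 : forall s, 0 <= v s.
Hypothesis v_super : forall s, \sum_o kern s o * v (rcons s o) <= v s.

Lemma max_principle (In : seq (outcome U) -> Prop) (f : seq (outcome U) -> R)
    (g : seq (outcome U) -> outcome U -> R) (B delta : R) :
  0 < delta -> (forall s, In s -> f s <= B) ->
  (forall s, In s -> f s + delta <= \sum_o kern s o * g s o) ->
  (forall s o, In s ->
     (In (rcons s o) /\ g s o <= f (rcons s o)) \/ g s o <= v (rcons s o)) ->
  forall s, In s -> f s <= v s.
Proof.
(* Near the supremum of [f - v] on [In], the gain [delta] would exceed it. *)
move=> delta_gt0 fB f_sub g_le s0 In0; rewrite leNgt; apply/negP => lt0.
pose E := [set f s - v s | s in [set s | In s]].
have E0 : has_sup E.
  split; first by exists (f s0 - v s0), s0.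
  exists B => _ [s /= Is <-]; rewrite lerBlDr.
  by apply: le_trans (fB s Is) _; rewrite lerDl.
have sup_gt0 : 0 < sup E.
  apply: lt_le_trans (_ : f s0 - v s0 <= _); first by rewrite subr_gt0.
  by apply: ub_le_sup => //; [exact: E0.2|exists s0].
have [_ [s /= Is <-] lt_s] := sup_adherent delta_gt0 E0.
have := f_sub s Is; apply/negP; rewrite -ltNge.
apply: le_lt_trans (_ : \sum_o kern s o * (v (rcons s o) + sup E) < _).
  apply: ler_sum => o _; rewrite ler_wpM2l ?kern_ge0 //.
  have [[Iso le_g]|le_g] := g_le s o Is; apply: le_trans le_g _; last first.
    by rewrite lerDl ltW.
  rewrite -lerBlDl; apply: ub_le_sup; [exact: E0.2|by exists (rcons s o)].
under eq_bigr do rewrite mulrDr.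
rewrite big_split /= -mulr_suml sum_kern // mul1r.
apply: le_lt_trans (lerD (v_super s) (lexx _)) _.
by move: lt_s; lra.
Qed.

Section active.
Variables (A : {set pot U}) (a : pot U -> bool).

(** [A] is the set of watched pots and [a i] the color meant to dominate pot [i]; a bad outcome
    contains a minority draw from a watched pot. *)
Definition bad (o : outcome U) : bool :=
  [exists u, (source (o u).1 u \in A) && ((o u).2 != a (source (o u).1 u))].

(** Union bound over the urns and the two draw types, whence [U.*2]. Each draw reads a single pot,
    whose [minority_prob] bound is enlarged to the whole sum over [A]. *)
Lemma sum_kern_bad s : (forall i, i \in A -> 0 < lead (a i) s i) ->
  \sum_o kern s o * (bad o)%:R <=
  (U.*2)%:R * C * \sum_(i in A) (lead (a i) s i ^+ 3)^-1.
Proof.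
move=> lead_gt0.
pose b u (e : bool * bool) := (source e.1 u \in A) && (e.2 != a (source e.1 u)).
set S := \sum_(i in A) _.
have C_ge0 : 0 <= C by apply: le_trans growth_const_ge1.
have urn u : \sum_e kern1 p w s u e * (b u e)%:R <= C * S + C * S.
  have half x : kern1 p w s u (x, true) * (b u (x, true))%:R
     + kern1 p w s u (x, false) * (b u (x, false))%:R <= C * S.
    have CS_ge0 : 0 <= C * S.
      by rewrite mulr_ge0 // sumr_ge0 // => i iA; rewrite invr_ge0 exprn_ge0 // ltW ?lead_gt0.
    rewrite /b /=; case: (boolP (source x u \in A)) => srcA /=; last by rewrite !mulr0 addr0.
    have one : kern1 p w s u (x, ~~ a (source x u)) <= C * S.
      apply: le_trans (_ : C * (lead (a (source x u)) s (source x u) ^+ 3)^-1 <= _).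
        rewrite /kern1 /= negbK.
        apply: le_trans (minority_prob (lead_gt0 _ srcA)).
        rewrite ler_piMl ?(ltW (reinf_prob_gt0 _ _ _)) //.
        by case: ifP => _ //; rewrite lerBlDr lerDl.
      rewrite ler_wpM2l // /S (bigD1 (source x u)) //= lerDl sumr_ge0 // => i /andP[iA _].
      by rewrite invr_ge0 exprn_ge0 // ltW ?lead_gt0.
    by case: (a _) one => /= one; rewrite !(mulr0, mulr1) ?addr0 ?add0r.
  by rewrite sum_bool2; apply: lerD.
apply: le_trans (_ : \sum_(u < U) (C * S + C * S) <= _); last first.
  by rewrite sumr_const card_ord -mulr2n -mulrA -mulr_natl -mulrnA mulr_natl -mul2n mulr_natl.
apply: le_trans (ler_sum _ (fun u _ => urn u)).
under [leRHS]eq_bigr => u _ do rewrite -(sum_kern_urn p w_gt0 s u (fun e => (b u e)%:R)).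
rewrite [leRHS]exchange_big; apply: ler_sum => o _.
rewrite -mulr_sumr ler_wpM2l ?kern_ge0 //.
case: (boolP (bad o)) => [/existsP[u bu]|_]; last by rewrite sumr_ge0.
by rewrite (bigD1 u) //= /b bu lerDl sumr_ge0.
Qed.

(* [step i u x] bounds from below the contribution of urn [u] to the
   increment of the lead of pot [i] when its draw has type [x] and nothing bad happens;
   it depends on the draw types only, whose law does not depend on the past. *)
Variables (step : pot U -> 'I_U -> bool -> R) (m K : R).
Hypothesis step_le1 : forall i u x, `|step i u x| <= 1.
Hypothesis m_gt0 : 0 < m.
Hypothesis mean_step : forall i, i \in A -> m <= mean p (step i).
Hypothesis K_ge : 1 + U%:R + 2 * U%:R ^+ 2 / m + 4 * U%:R * C / m <= K.

Definition safe s := forall i, i \in A -> K <= lead (a i) s i.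

Definition risk s := K * \sum_(i in A) (lead (a i) s i)^-1.

(** A bad draw costs 1, and each increment of a lead is replaced by its lower estimate [total_step],
    whose mean is explicit. *)
Definition next_risk s o :=
  (bad o)%:R + K * \sum_(i in A) (lead (a i) s i + total_step (step i) o)^-1.

(** The last two bounds let the drift pay for the second-order term of [inv_step] and for the bad
    draws, each charged to one half of [m]. *)
Lemma K_facts : [/\ 1 <= K, U%:R + 1 <= K, U%:R ^+ 2 <= m / 2 * (K - U%:R)
  & (U.*2)%:R * C <= m / 2 * K].
Proof.
have C1 := growth_const_ge1; have U0 : 0 <= U%:R :> R by [].
have t1 : 0 <= 2 * U%:R ^+ 2 / m by rewrite divr_ge0 ?mulr_ge0 ?exprn_ge0 // ltW.
have t2 : 0 <= 4 * U%:R * C / m.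
  by rewrite divr_ge0 ?mulr_ge0 ?(ltW m_gt0) // (le_trans ler01).
have e1 : U%:R ^+ 2 = m / 2 * (2 * U%:R ^+ 2 / m) by field; rewrite gt_eqF.
have e2 : (U.*2)%:R * C = m / 2 * (4 * U%:R * C / m).
  by rewrite -mul2n natrM; field; rewrite gt_eqF.
have m2 : 0 <= m / 2 by rewrite divr_ge0 // ltW.
have K1 := K_ge.
split; [lra|lra|rewrite e1|rewrite e2]; apply: ler_wpM2l => //; lra.
Qed.

(** Second-order expansion with exact remainder [D ^+ 2 / (Q ^+ 2 * (Q + D))], then enlarged through
    [|D| <= B]. *)
Lemma inv_step (Q D B : R) : 0 < Q -> `|D| <= B -> B < Q ->
  (Q + D)^-1 <= Q^-1 - D / Q ^+ 2 + B ^+ 2 / (Q ^+ 2 * (Q - B)).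
Proof.
rewrite ler_norml => Q0 /andP[D1 D2] BQ.
have -> : (Q + D)^-1 = Q^-1 - D / Q ^+ 2 + D ^+ 2 / (Q ^+ 2 * (Q + D)).
  by field; rewrite !gt_eqF //; lra.
rewrite lerD2l ler_pM ?sqr_ge0 ?invr_ge0 ?mulr_ge0 ?exprn_ge0 //; try lra.
  by nra.
rewrite lef_pV2 ?posrE ?mulr_gt0 ?exprn_gt0 ?ler_pM2l ?exprn_gt0 //; lra.
Qed.

(** The drift lowers the mean of each term [K / Q] by at least [K * m / Q ^+ 2]. Half of this gain
    absorbs the bad draws ([g1]), the other half the second-order remainder ([g2]). *)
Lemma sum_kern_next_risk s : safe s ->
  \sum_o kern s o * next_risk s o <= risk s.
Proof.
move=> safe_s; have [K1 KU KU2 KC] := K_facts.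
have U0 : 0 <= U%:R :> R by [].
have Q_gt0 i : i \in A -> 0 < lead (a i) s i.
  by move=> /safe_s; apply: lt_le_trans; lra.
under eq_bigr do rewrite mulrDr.
rewrite big_split /=.
apply: le_trans (lerD (sum_kern_bad Q_gt0) (lexx _)) _.
have -> : \sum_o kern s o * (K * \sum_(i in A) (lead (a i) s i + total_step (step i) o)^-1)
  = K * \sum_(i in A) \sum_o kern s o * (lead (a i) s i + total_step (step i) o)^-1.
  rewrite exchange_big mulr_sumr; apply: eq_bigr => o _.
  by rewrite !mulr_sumr; apply: eq_bigr => i _; ring.
rewrite /risk !mulr_sumr -big_split /=; apply: ler_sum => i iA.
have := Q_gt0 i iA; have := safe_s i iA.
move: (lead (a i) s i) => Q QK Q0.
have h : \sum_o kern s o * (Q + total_step (step i) o)^-1 <=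
    Q^-1 - m / Q ^+ 2 + U%:R ^+ 2 / (Q ^+ 2 * (Q - U%:R)).
  apply: le_trans (_ : \sum_o kern s o * (Q^-1 + U%:R ^+ 2 / (Q ^+ 2 * (Q - U%:R))
      - total_step (step i) o / Q ^+ 2) <= _).
    apply: ler_sum => o _; apply: ler_wpM2l; first exact: kern_ge0.
    apply: le_trans (inv_step Q0 (total_step_norm _ _) _) _ => //; first by lra.
    by rewrite addrAC.
  under eq_bigr do rewrite mulrBr mulrA.
  rewrite sumrB -mulr_suml -mulr_suml sum_kern // mul1r sum_kern_total_step //.
  have : m / Q ^+ 2 <= mean p (step i) / Q ^+ 2.
    by rewrite ler_wpM2r ?invr_ge0 ?exprn_ge0 ?mean_step // ltW.
  lra.
apply: le_trans (lerD (lexx _) (ler_wpM2l _ h)) _; first by lra.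
have g1 : (U.*2)%:R * C / Q ^+ 3 <= m / 2 * K / Q ^+ 2.
  have -> : m / 2 * K / Q ^+ 2 = m / 2 * K * Q / Q ^+ 3 by field; rewrite gt_eqF.
  rewrite ler_wpM2r ?invr_ge0 ?exprn_ge0 ?(ltW Q0) //.
  apply: le_trans KC _; apply: ler_peMr; last exact: le_trans QK.
  by apply: mulr_ge0; [rewrite divr_ge0 // ltW|exact: le_trans K1].
have g2 : U%:R ^+ 2 / (Q ^+ 2 * (Q - U%:R)) <= m / 2 / Q ^+ 2.
  rewrite invfM mulrCA mulrC ler_wpM2r ?invr_ge0 ?exprn_ge0 ?(ltW Q0) //.
  rewrite ler_pdivrMr; last by lra.
  by apply: le_trans KU2 _; rewrite ler_wpM2l ?lerD2r // divr_ge0 // ltW.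
have := ler_wpM2l (le_trans ler01 K1) g2.
have -> : K * (m / 2 / Q ^+ 2) = m / 2 * K / Q ^+ 2 by ring.
have -> : K * (Q^-1 - m / Q ^+ 2 + U%:R ^+ 2 / (Q ^+ 2 * (Q - U%:R)))
  = K * Q^-1 - 2 * (m / 2 * K / Q ^+ 2) + K * (U%:R ^+ 2 / (Q ^+ 2 * (Q - U%:R))).
  by field; rewrite !gt_eqF //; lra.
by move: g1; lra.
Qed.

Hypothesis step_dlead : forall o i, ~~ bad o -> i \in A ->
  total_step (step i) o <= dlead (a i) o i.

Lemma next_lead_gt0 s o i : safe s -> i \in A ->
  0 < lead (a i) s i + total_step (step i) o.
Proof.
move=> /[apply] h; have [K1 KU _ _] := K_facts.
have := total_step_norm o (step_le1 i); rewrite ler_norml => /andP[d1 d2]; lra.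
Qed.

Lemma next_risk_ge0 s o : safe s -> 0 <= next_risk s o.
Proof.
move=> h; have [K1 _ _ _] := K_facts; rewrite addr_ge0 // mulr_ge0 //; first by lra.
by rewrite sumr_ge0 // => i iA; rewrite invr_ge0 ltW // next_lead_gt0.
Qed.

Lemma next_risk_bad s o : safe s -> bad o -> 1 <= next_risk s o.
Proof.
move=> h bo; have [K1 _ _ _] := K_facts; rewrite /next_risk bo lerDl mulr_ge0 //; first by lra.
by rewrite sumr_ge0 // => i iA; rewrite invr_ge0 ltW // next_lead_gt0.
Qed.

(** Leaving the safe region needs no separate accounting: a lead falling below [K] already
    contributes at least 1 to [next_risk]. *)
Lemma next_risk_cases s o : safe s -> ~~ bad o ->
  1 <= next_risk s o \/
  (safe (rcons s o) /\ risk (rcons s o) <= next_risk s o).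
Proof.
move=> h nbo; have [K1 _ _ _] := K_facts.
have K0 : 0 < K by lra.
case: (boolP [forall i in A, K <= lead (a i) (rcons s o) i]) => [/forall_inP h'|].
  right; split => //; rewrite /next_risk /risk -[leLHS]add0r lerD //.
  rewrite ler_pM2l //; apply: ler_sum => i iA.
  rewrite lef_pV2 ?posrE ?next_lead_gt0 //.
    by rewrite lead_rcons lerD2l step_dlead.
  by apply: lt_le_trans (h' i iA).
rewrite negb_forall => /existsP[i]; rewrite negb_imply -ltNge => /andP[iA lt_K].
left; rewrite /next_risk (bigD1 i) //= mulrDr.
have q0 := next_lead_gt0 o h iA.
have t : 1 <= K * (lead (a i) s i + total_step (step i) o)^-1.
  rewrite ler_pdivlMr // mul1r; apply: le_trans (ltW lt_K).
  by rewrite lead_rcons lerD2l step_dlead.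
apply: le_trans t _; rewrite addrCA lerDl addr_ge0 // mulr_ge0 ?(ltW K0) //.
by rewrite sumr_ge0 // => j /andP[jA _]; rewrite invr_ge0 ltW // next_lead_gt0.
Qed.

Lemma risk_le s (L : R) : K <= L -> (forall i, i \in A -> L <= lead (a i) s i) ->
  risk s <= K * (U.+1)%:R / L.
Proof.
move=> KL h; have [K1 _ _ _] := K_facts; have L0 : 0 < L by lra.
rewrite /risk -mulrA ler_wpM2l //; first by lra.
apply: le_trans (_ : \sum_(i in A) L^-1 <= _).
  apply: ler_sum => i /h h1; rewrite lef_pV2 ?posrE //; exact: lt_le_trans h1.
rewrite sumr_const -[leLHS]mulr_natl ler_wpM2r ?invr_ge0 ?(ltW L0) // ler_nat.
by apply: leq_trans (max_card _) _; rewrite card_option card_ord.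
Qed.

Lemma risk_ge0 s : safe s -> 0 <= risk s.
Proof.
move=> h; have [K1 _ _ _] := K_facts; rewrite mulr_ge0 //; first by lra.
by rewrite sumr_ge0 // => i /h iK; rewrite invr_ge0; lra.
Qed.

(** [1 - risk] does not decrease in mean, and its estimate is at most 0 when a bad draw or an unsafe
    lead occurs. The condition [kern s o != 0] lets combined draws be discarded when [p = 0]. *)
Lemma surv_ge (ok : pred (outcome U)) n s :
  (forall s o, kern s o != 0 -> ~~ bad o -> ok o) ->
  safe s -> 1 - risk s <= surv ok n s.
Proof.
move=> bad_ok; elim: n s => [|n IHn] s safe_s /=.
  by rewrite lerBlDr lerDl risk_ge0.
apply: le_trans (_ : \sum_o kern s o * (1 - next_risk s o) <= _).
  under eq_bigr do rewrite mulrBr mulr1.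
  by rewrite sumrB sum_kern // lerD2l lerN2 sum_kern_next_risk.
apply: ler_sum => o _; have [->|k0] := eqVneq (kern s o) 0; first by rewrite !mul0r.
apply: ler_wpM2l; first exact: kern_ge0.
have r_ge0 : 0 <= (ok o)%:R * surv ok n (rcons s o) by rewrite mulr_ge0 ?surv_ge0.
have triv : 1 <= next_risk s o -> 1 - next_risk s o <= (ok o)%:R * surv ok n (rcons s o).
  by move=> h; apply: le_trans r_ge0; rewrite subr_le0.
have [/(next_risk_bad safe_s)/triv//|nbad] := boolP (bad o).
have [/triv//|[safe_so le_risk]] := next_risk_cases safe_s nbad.
rewrite (bad_ok _ _ k0 nbad) mul1r; apply: le_trans (IHn _ safe_so).
by rewrite lerD2l lerN2.
Qed.

(** * Leads with nonnegative drift *)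

Section reach.
Variables (aw : bool) (iw : pot U) (sw : 'I_U -> bool -> R) (sigma theta : R).
Hypothesis sw_le1 : forall u x, `|sw u x| <= 1.
Hypothesis sw_dlead : forall o, ~~ bad o -> total_step sw o <= dlead aw o iw.
Hypothesis mean_sw : 0 <= mean p sw.
Hypothesis sigma_gt0 : 0 < sigma.
Hypothesis sw_var : forall s, sigma <= \sum_o kern s o * total_step sw o ^+ 2.
Hypothesis theta_gt0 : 0 < theta.
Hypothesis target : forall s, safe s -> 0 <= lead aw s iw -> theta <= v s.

(* The quadratic [((y + M)^2 - U^2) / (M + U)^2] of the walk [y = lead aw _ iw] is at
   most 1 up to the overshoot of 0, at most 0 below [-M], and its mean increases at each
   step; the max principle compares it, minus the risk, with [v]. *)
Lemma reach s : safe s -> theta * (4^-1 - risk s) <= v s.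
Proof.
move=> safe_s; have b_ge0 : 0 <= U%:R :> R by [].
have risk_s := risk_ge0 safe_s.
have [ge0|lt0] := leP 0 (lead aw s iw).
  by apply: le_trans (target safe_s ge0); rewrite ger_pMr //; lra.
(* Starting from [-d], this choice gives [((d + 2U)^2 - U^2) / (2d + 3U)^2], which is at least
   1/4. *)
pose M : R := 2 * (- lead aw s iw) + 2 * U%:R.
have M_gt0 : 0 < M by rewrite /M; lra.
pose f y : R := ((y + M) ^+ 2 - U%:R ^+ 2) / (M + U%:R) ^+ 2.
pose In s' := [/\ safe s', - M < lead aw s' iw & lead aw s' iw < 0].
have Mb2_gt0 : 0 < (M + U%:R) ^+ 2 by rewrite exprn_gt0 //; lra.
have f_le1 y : - M - U%:R <= y -> y <= U%:R -> f y <= 1.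
  move=> y1 y2; rewrite /f ler_pdivrMr // mul1r.
  have : 0 <= (U%:R - y) * (y + 2 * M + U%:R) by rewrite mulr_ge0 //; lra.
  by have := sqr_ge0 (U%:R : R); lra.
have f_le0 y : - U%:R <= y + M -> y + M <= U%:R -> f y <= 0.
  move=> y1 y2; rewrite /f ler_pdivrMr // mul0r.
  have : 0 <= (U%:R - (y + M)) * (U%:R + (y + M)) by rewrite mulr_ge0 //; lra.
  lra.
have f_mono y z : 0 <= y + M -> y <= z -> f y <= f z.
  move=> y1 y2; rewrite /f ler_pM2r ?invr_gt0 // lerD2r.
  by rewrite lerXn2r ?nnegrE //; lra.
have In_s : In s by split=> //; rewrite /M; lra.
have f_s : 4^-1 <= f (lead aw s iw).
  rewrite /f ler_pdivlMr // /M; move: lt0 b_ge0.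
  move: (lead aw s iw) (U%:R : R) => y b y0 b0.
  by have := mulr_ge0 b0 (ltW (_ : 0 < - y)); nra.
have := @max_principle In (fun s => theta * (f (lead aw s iw) - risk s))
   (fun s o => theta * (f (lead aw s iw + total_step sw o) - next_risk s o)) theta
   (theta * (sigma / (M + U%:R) ^+ 2)).
move=> /(_ _ _ _ _ s In_s) mp.
apply: le_trans (mp _ _ _ _).
- by rewrite ler_wpM2l ?(ltW theta_gt0) // lerD2r.
- by rewrite mulr_gt0 // divr_gt0.
- move=> s' [/risk_ge0 r0 y1 y2]; rewrite ger_pMr // lerBlDr.
  by apply: le_trans (f_le1 _ _ _) _; lra.
- move=> s' [safe_s' y1 y2].
  under eq_bigr do rewrite mulrCA.
  rewrite -mulr_sumr -mulrDr ler_wpM2l ?(ltW theta_gt0) //.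
  under eq_bigr do rewrite mulrBr.
  rewrite sumrB addrAC; apply: lerB; last exact: sum_kern_next_risk.
  move: (lead aw s' iw) y1 y2 => y y1 y2.
  (* The square is expanded exactly: the linear term has nonnegative mean because [y + M > 0], and
     the quadratic term supplies the gain. *)
  apply: le_trans (_ : \sum_o kern s' o *
     (f y + total_step sw o * (2 * (y + M) / (M + U%:R) ^+ 2) +
      total_step sw o ^+ 2 / (M + U%:R) ^+ 2) <= _); last first.
    apply: ler_sum => o _; rewrite ler_wpM2l ?kern_ge0 // /f le_eqVlt.
    by apply/orP; left; apply/eqP; field; rewrite gt_eqF //; lra.
  under eq_bigr do rewrite mulrDr [X in X + _]mulrDr [X in _ + X + _]mulrA [X in _ + _ + X]mulrA.
  rewrite !big_split /= -!mulr_suml sum_kern // mul1r sum_kern_total_step //.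
  rewrite -addrA lerD2l -[leLHS]add0r lerD // ?ler_pM2r ?invr_gt0 //.
  apply: mulr_ge0 => //; apply: divr_ge0; last exact: ltW.
  by apply: mulr_ge0 => //; rewrite -lerBlDr sub0r ltW.
move=> s' o [safe_s' y1 y2].
have := total_step_norm o sw_le1; rewrite ler_norml => /andP[D1 D2].
have nr0 := next_risk_ge0 o safe_s'.
have small : f (lead aw s' iw + total_step sw o) <= next_risk s' o ->
    theta * (f (lead aw s' iw + total_step sw o) - next_risk s' o) <= v (rcons s' o).
  move=> h; apply: le_trans (v_ge0 _); rewrite pmulr_rle0 // subr_le0 //.
have le1 : f (lead aw s' iw + total_step sw o) <= 1 by apply: f_le1; lra.
have [bo|nbad] := boolP (bad o).
  by right; apply: small; apply: le_trans le1 (next_risk_bad safe_s' bo).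
have [r1|[safe_so le_risk]] := next_risk_cases safe_s' nbad.
  by right; apply: small; apply: le_trans r1.
(* [f] is increasing only to the right of [-M], so a low estimate is settled by [f <= 0] before the
   estimate is compared with the true lead. *)
have [low|high] := leP (lead aw s' iw + total_step sw o + M) 0.
  by right; apply: small; apply: le_trans nr0; apply: f_le0; lra.
have dl := sw_dlead nbad.
have E : lead aw (rcons s' o) iw = lead aw s' iw + dlead aw o iw by exact: lead_rcons.
have [ge0|lt0'] := leP 0 (lead aw (rcons s' o) iw).
  right; apply: le_trans (target safe_so ge0).
  by rewrite ger_pMr //; lra.
left; split; first by split=> //; lra.
rewrite ler_pM2l //; apply: lerB => //.
by apply: f_mono; lra.
Qed.

End reach.

End active.

(** * Forced steps and safe distances *)

Lemma lead_cat_nseq a s n o i :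
  lead a (s ++ nseq n o) i = lead a s i + n%:R * dlead a o i.
Proof.
elim: n s => [|n IHn] s; first by rewrite cats0 mul0r addr0.
rewrite /= -cat_rcons IHn lead_rcons -addn1 natrD; ring.
Qed.

(** Superharmonicity is used keeping only the term of [o]. Every urn draws a color that leads its
    pot, at price [q / (1 + C)], and [dlead >= 0] preserves this for the next repetition. *)
Lemma forced_outcomes n s (o : outcome U) q : 0 <= q ->
  (forall u, q <= if (o u).1 then p else 1 - p) ->
  (forall u, 0 <= lead (o u).2 s (source (o u).1 u)) ->
  (forall u, 0 <= dlead (o u).2 o (source (o u).1 u) :> R) ->
  ((q / (1 + C)) ^+ U) ^+ n * v (s ++ nseq n o) <= v s.
Proof.
move=> q0 q_le lead_ge0 dlead_ge0; have C1 := growth_const_ge1.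
have r0 : 0 <= q / (1 + C) by rewrite divr_ge0 //; lra.
elim: n s lead_ge0 => [|n IHn] s lead_ge0; first by rewrite cats0 mul1r.
rewrite /= -cat_rcons exprS -mulrA.
have le1 : (q / (1 + C)) ^+ U * v (rcons s o) <= v s.
  apply: le_trans (v_super s); rewrite (bigD1 o) //= ler_wpDr //.
    by apply: sumr_ge0 => o' _; rewrite mulr_ge0 ?kern_ge0.
  rewrite ler_wpM2r // -[X in _ ^+ X]card_ord -prodr_const; apply: ler_prod => u _.
  rewrite r0 /kern1 /= ler_pM ?invr_ge0 //; first by lra.
  exact: majority_prob.
apply: le_trans le1; rewrite ler_wpM2l ?exprn_ge0 //; apply: IHn => u.
by rewrite lead_rcons addr_ge0.
Qed.

(** With [S] full, every ball has color [c], so the same pattern serves both claims. *)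
Definition rule (c : bool) (S : {set 'I_U}) (o : outcome U) : bool :=
  [forall u, (o u).2 == if (o u).1 || (u \in S) then c else ~~ c].

Lemma natr_upper (x : R) : exists n : nat, x <= n%:R.
Proof.
exists (Num.Def.archi_bound `|x|); apply: le_trans (ler_norm x) _.
by rewrite ltW // archi_boundP.
Qed.

(** The factor 8 brings the risk down to 1/8, which is below the 1/4 of [reach] and leaves survival
    probability 7/8. *)
Definition far (K : R) (J : nat) := K <= J%:R /\ 8 * (K * U.+1%:R) <= J%:R.

Lemma far_exists K : exists J, far K J.
Proof.
have [J h] := natr_upper (Num.max K (8 * (K * U.+1%:R))).
by exists J; move: h; rewrite ge_max => /andP[].
Qed.

Lemma risk_far (A : {set pot U}) a m K (J : nat) s : 0 < m ->
  1 + U%:R + 2 * U%:R ^+ 2 / m + 4 * U%:R * C / m <= K -> far K J ->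
  (forall i, i \in A -> J%:R <= lead (a i) s i) ->
  safe A a K s /\ risk A a K s <= 8^-1.
Proof.
move=> m0 K_ge [KJ J8] h; have [K1 _ _ _] := K_facts m0 K_ge.
split=> [i /h|]; first exact: le_trans.
apply: le_trans (risk_le m0 K_ge KJ h) _.
by rewrite ler_pdivrMr; lra.
Qed.

Lemma sum_kern_cst s (F : outcome U -> R) x :
  (forall o, F o = x) -> \sum_o kern s o * F o = x.
Proof.
by move=> Fx; under eq_bigr do rewrite Fx; rewrite -mulr_suml sum_kern // mul1r.
Qed.

Hypothesis U_gt0 : (0 < U)%N.

Definition all_outcome c : outcome U := [ffun=> (true, c)].

Lemma dlead_all_outcome c i :
  dlead c (all_outcome c) i = if i is Some u then 1 else U%:R :> R.
Proof.
rewrite /dlead /sgc; case: i => [u|] /=; first by rewrite ffunE eqxx.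
under eq_bigr do rewrite ffunE eqxx.
by rewrite sumr_const card_ord.
Qed.

(** * Lower bound for p >= 1/2 *)

Section strong.
Hypothesis p_ge_half : 2^-1 <= p.
Hypothesis v_rule : forall c s r,
  (forall n, r <= surv (rule c [set: _]%SET) n s) -> r <= v s.

Definition hub (B : {set 'I_U}) : {set pot U} :=
  [set i | if i is Some u then u \in B else true]%SET.

(** Worst case without bad draws: urns of [B] always receive [c], the others are sure to receive it
    on combined draws only. *)
Definition hub_step (B : {set 'I_U}) (i : pot U) (u : 'I_U) (x : bool) : R :=
  if i is Some u' then (u == u')%:R else if x || (u \in B) then 1 else -1.

Lemma hub_step_le1 B i u x : `|hub_step B i u x| <= 1.
Proof.
rewrite /hub_step; case: i => [u'|]; first by case: eqP; rewrite ?normr1 ?normr0.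
by case: ifP; rewrite ?normrN normr1.
Qed.

(** For the combined pot, an urn of [B] contributes 1 and any other urn at least [2p - 1 >= 0];
    hence one urn in [B] suffices. *)
Lemma mean_hub_step (B : {set 'I_U}) i : B != finset.set0 -> 1 <= mean p (hub_step B i).
Proof.
rewrite /mean /hub_step => /set0Pn[u0 u0B]; case: i => [u'|].
  rewrite (bigD1 u') //= eqxx big1 => [|u /negPf -> /=]; first by rewrite /=; lra.
  by rewrite !mulr0n !mulr0 addr0.
rewrite (bigD1 u0) //= u0B; apply: le_trans (_ : (p * 1 + (1 - p) * 1) + 0 <= _).
  by lra.
rewrite lerD2l sumr_ge0 // => u _ /=; move: p_ge_half.
by case: ifP => _; lra.
Qed.

Lemma hub_step_dlead c B o i : ~~ bad (hub B) (fun=> c) o -> i \in hub B ->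
  total_step (hub_step B i) o <= dlead c o i.
Proof.
rewrite negb_exists => /forallP nbad iB.
have col u : (o u).1 || (u \in B) -> (o u).2 = c.
  move: (nbad u); rewrite /source inE; case: (o u).1 => /=; first by move/negPn/eqP.
  by move=> + uB; rewrite uB => /negPn/eqP.
rewrite /total_step /hub_step /dlead; case: i iB => [u'|_].
  rewrite inE => uB; rewrite (bigD1 u') //= eqxx big1 => [|u /negPf ->//].
  by rewrite addr0 /sgc col ?eqxx // uB orbT.
apply: ler_sum => u _; case: ifP => [/col ->|_]; first by rewrite /sgc eqxx.
by rewrite /sgc; case: ifP => _; lra.
Qed.

(** Induction on a bound [k] for the number of urns outside [B]. Forced draws of [c] make the hub
    safe; then the lead of some urn outside [B] reaches 0 by [reach], and this urn joins [B]. For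
    [k = 0] the hub is everything and survival alone concludes. *)
Lemma strong_stage k : exists2 theta, 0 < theta & forall c (B : {set 'I_U}) s,
  B != finset.set0 -> (U <= #|B| + k)%N -> (forall i, i \in hub B -> 0 <= lead c s i) ->
  theta <= v s.
Proof.
have C1 := growth_const_ge1; have p_half := p_ge_half.
pose K : R := 1 + U%:R + 2 * U%:R ^+ 2 / 1 + 4 * U%:R * C / 1.
have [J farJ] := far_exists K.
pose ka := ((p / (1 + C)) ^+ U) ^+ J.
have ka0 : 0 < ka by rewrite !exprn_gt0 // divr_gt0 //; lra.
pose o := all_outcome.
have U1 : 1 <= U%:R :> R by rewrite ler1n.
have dl c i : 1 <= dlead c (o c) i :> R by rewrite dlead_all_outcome; case: i.
have force c s : 0 <= lead c s None -> ka * v (s ++ nseq J (o c)) <= v s.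
  move=> h; apply: forced_outcomes => // u; rewrite ffunE //=.
  exact: le_trans ler01 (dl c None).
have forced c s i : 0 <= lead c s i -> J%:R <= lead c (s ++ nseq J (o c)) i.
  move=> h; rewrite lead_cat_nseq -[leLHS]add0r lerD // ler_peMr //.
have noneB B : None \in hub B by rewrite inE.
elim: k => [|k [theta theta0 IHk]].
  exists (ka * 2^-1) => [|c B s B0 UB ge0]; first by rewrite mulr_gt0 ?invr_gt0.
  apply: le_trans (force c s (ge0 _ (noneB _))); rewrite ler_pM2l //.
  have [safe_s risk_s] := @risk_far (hub B) (fun=> c) 1 K J _ ltr01 (lexx _) farJ
    (fun i iB => forced c s i (ge0 i iB)).
  apply: (@v_rule c) => n.
  apply: le_trans (_ : 1 - risk (hub B) (fun=> c) K (s ++ nseq J (o c)) <= _).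
    lra.
  apply: (surv_ge (hub_step_le1 B) ltr01 _ (lexx _) (@hub_step_dlead c B) n _ safe_s).
    by move=> i _; exact: mean_hub_step.
  move=> s' o' _; rewrite negb_exists => /forallP nbad; apply/forallP => u.
  have BT : B = [set: _]%SET.
    by apply/eqP; rewrite eqEcard finset.subsetT cardsT card_ord; move: UB; rewrite addn0.
  rewrite inE orbT; move: (nbad u); rewrite BT /source !inE.
  by case: (o' u).1; rewrite ?inE /= => /negPn.
(* The factor 1/8 is what remains of the 1/4 of [reach] after a risk of at most 1/8; the minimum
   also covers sets already large enough for the induction hypothesis. *)
exists (Num.min theta (ka * (theta * 8^-1))) => [|c B s B0 UB ge0].
  by rewrite lt_min theta0 !mulr_gt0 ?invr_gt0.
rewrite ge_min; have [UBk|ltB] := leqP U (#|B| + k); first by rewrite (IHk c B).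
apply/orP; right.
have [u uB] : exists u, u \notin B.
  apply/existsP; rewrite -negb_forall; apply/negP => /forallP allB.
  move: ltB; rewrite ltnNge => /negP; apply; rewrite -{1}(card_ord U).
  by apply: leq_trans (leq_addr _ _); apply: subset_leq_card;
     apply/fintype.subsetP => u _; exact: allB.
apply: le_trans (force c s (ge0 _ (noneB _))); rewrite ler_pM2l //.
have [safe_s risk_s] := @risk_far (hub B) (fun=> c) 1 K J _ ltr01 (lexx _) farJ
    (fun i iB => forced c s i (ge0 i iB)).
(* A combined draw gives [c] to urn [u] unless it is bad; a draw from [u] alone is counted as a
   loss. *)
pose sw v x : R := if v == u then (if x then 1 else -1) else 0.
have tsw o' : total_step sw o' = if (o' u).1 then 1 else -1.
  by rewrite /total_step /sw (bigD1 u) //= eqxx big1 ?addr0 // => v' /negPf ->.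
apply: le_trans (_ : theta * (4^-1 - risk (hub B) (fun=> c) K (s ++ nseq J (o c))) <= _).
  by rewrite ler_pM2l //; lra.
apply: (@reach (hub B) (fun=> c) (hub_step B) 1 K (hub_step_le1 B) ltr01 _
   (lexx _) (@hub_step_dlead c B) c (Some u) sw 1) => //.
- by move=> i _; exact: mean_hub_step.
- by move=> v' x; rewrite /sw; case: ifP => _; rewrite ?normr0 //; case: x; rewrite ?normrN normr1.
- move=> o' nbad; rewrite tsw /dlead; case: ifP => [x|_]; last by rewrite /sgc; case: ifP; lra.
  have : (o' u).2 = c.
    by move: nbad; rewrite negb_exists => /forallP/(_ u); rewrite x inE /= => /negPn/eqP.
  by rewrite /sgc => ->; rewrite eqxx.
- rewrite /mean (bigD1 u) //= /sw eqxx big1 => [|v' /negPf ->].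
    by move: p_ge_half; lra.
  by rewrite !mulr0 addr0.
- move=> s'; rewrite (sum_kern_cst s' (x := 1)) // => o'.
  by rewrite tsw; case: ifP; rewrite ?sqrrN expr1n.
move=> s' safe_s' ge0'; apply: (IHk c (u |: B)%SET).
- by apply/set0Pn; exists u; rewrite finset.setU11.
- by rewrite cardsU1 uB add1n addSnnS.
move=> i; rewrite inE; case: i => [u'|] => [|_]; last first.
  have [K1 _ _ _] := K_facts ltr01 (lexx K).
  by apply: le_trans (safe_s' None (noneB _)); lra.
rewrite !inE => /orP[/eqP -> //|u'B].
apply: le_trans (safe_s' (Some u') _); last by rewrite inE.
by have [K1 _ _ _] := K_facts (ltr01) (lexx K); lra.
Qed.

(** The combined lead is the sum of the urn leads, so some urn shares the combined majority color
    and can serve as the initial [B]. *)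
Lemma strong_lower_bound : exists2 theta, 0 < theta & forall s, theta <= v s.
Proof.
have [theta theta0 h] := strong_stage U.
exists theta => // s.
have [c ge0] : exists c, 0 <= lead c s None.
  by have [|] := leP 0 (lead true s None); [exists true|exists false; rewrite (leadN _ true) oppr_ge0 ltW].
have [u u_ge0] : exists u, 0 <= lead c s (Some u).
  apply/existsP; apply: contraLR ge0; rewrite negb_exists => /forallP neg.
  rewrite -ltNge lead_sum (bigD1 (Ordinal U_gt0)) //=.
  rewrite -[ltRHS]addr0 ltr_leD ?ltNge ?neg //.
  by apply: sumr_le0 => u _; rewrite ltW // ltNge neg.
apply: (h c [set u]%SET) => [||[u'|]]; rewrite ?inE ?leq_addl //.
- by apply/set0Pn; exists u; rewrite inE.
- by move/eqP ->.
Qed.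

End strong.

(** * Lower bound for p < 1/2 *)

Section weak.
Hypothesis p_lt_half : p < 2^-1.
Hypothesis v_rule : forall c (S : {set 'I_U}) s r, S != finset.set0 ->
  (forall n, r <= surv (rule c S) n s) -> r <= v s.

(** Profile in which [c] dominates the combined pot and the urns of [S], and [~~ c] the other
    urns. *)
Definition own (c : bool) (S : {set 'I_U}) (i : pot U) : bool :=
  if i is Some u then (if u \in S then c else ~~ c) else c.

(** For a single urn every combined draw is counted as a loss, which leaves it the drift
    [1 - 2p > 0]. *)
Definition own_step (S : {set 'I_U}) (i : pot U) (u : 'I_U) (x : bool) : R :=
  if i is Some u' then (if u == u' then (if x then -1 else 1) else 0)
  else if x || (u \in S) then 1 else -1.

Definition excess (S : {set 'I_U}) : R := \sum_(u < U) (if u \in S then 1 else -1).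

(* The mean increment of the combined lead of [c] when the urns of [S] draw [c], the
   others draw [~~ c], and combined draws give [c]. *)
Definition drift (S : {set 'I_U}) : R := p * U%:R + (1 - p) * excess S.

Lemma excessC S : excess (~: S)%SET = - excess S.
Proof.
rewrite /excess -sumrN; apply: eq_bigr => u _; rewrite inE.
by case: ifP; case: ifP => //; rewrite opprK.
Qed.

Lemma driftC S : drift S + drift (~: S)%SET = 2 * p * U%:R.
Proof. by rewrite /drift excessC; ring. Qed.

(** Ensures that a set of positive drift is nonempty, as [v_rule] demands. *)
Lemma drift_set0 : drift finset.set0 <= 0.
Proof.
have -> : drift finset.set0 = (2 * p - 1) * U%:R.
  rewrite /drift /excess (eq_bigr (fun=> -1)) => [|u _]; last by rewrite inE.
  by rewrite sumrN sumr_const card_ord; ring.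
by rewrite mulr_le0_ge0 //; move: p_lt_half; lra.
Qed.

Lemma mean_own_step S i :
  mean p (own_step S i) = if i is Some u then 1 - 2 * p else drift S.
Proof.
rewrite /mean /own_step; case: i => [u'|].
  rewrite (bigD1 u') //= eqxx big1 => [|u /negPf ->]; first by ring.
  by rewrite !mulr0 addr0.
rewrite /drift /excess mulr_sumr -[U in p * U%:R]card_ord -sumr_const mulr_sumr -big_split /=.
by apply: eq_bigr => u _; case: ifP => _; ring.
Qed.

Lemma own_step_le1 S i u x : `|own_step S i u x| <= 1.
Proof.
rewrite /own_step; case: i => [u'|]; last by case: ifP; rewrite ?normrN normr1.
by case: eqP; case: x; rewrite ?normrN ?normr1 ?normr0.
Qed.

Lemma total_own_step S u o :
  total_step (own_step S (Some u)) o = if (o u).1 then -1 else 1.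
Proof.
by rewrite /total_step (bigD1 u) //= eqxx big1 ?addr0 // => u' /negPf ->.
Qed.

Lemma bad_own (A : {set pot U}) c S (o : outcome U) u :
  (forall u, Some u \in A) -> ~~ bad A (own c S) o ->
  ~~ (o u).1 -> (o u).2 = if u \in S then c else ~~ c.
Proof.
move=> indA; rewrite negb_exists => /forallP/(_ u) + /negPf x.
by rewrite x /= indA => /negPn/eqP.
Qed.

Lemma own_step_dlead (A : {set pot U}) c S (o : outcome U) i : (forall u, Some u \in A) ->
  ~~ bad A (own c S) o -> i \in A ->
  total_step (own_step S i) o <= dlead (own c S i) o i.
Proof.
move=> indA nbad; case: i => [u _|NA].
  rewrite total_own_step /= /sgc; case: ifP => x; first by case: ifP; lra.
  by rewrite (bad_own indA nbad (negbT x)) eqxx.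
apply: ler_sum => u _; rewrite /= /sgc; case: (boolP (o u).1) => x /=.
  move: nbad; rewrite negb_exists => /forallP/(_ u).
  by rewrite x /= NA => /negPn/eqP ->; rewrite eqxx.
rewrite (bad_own indA nbad x); case: ifP => uS; first by rewrite eqxx.
by case: ifP; lra.
Qed.

Definition own_outcome (c : bool) (S : {set 'I_U}) : outcome U :=
  [ffun u => (false, if u \in S then c else ~~ c)].

Lemma dlead_own_outcome c S i :
  dlead (own c S i) (own_outcome c S) i = if i is Some u then 1 else excess S.
Proof.
rewrite /dlead /sgc; case: i => [u|] /=; first by rewrite ffunE eqxx.
by apply: eq_bigr => u _; rewrite ffunE /=; case: (u \in S); case: (c).
Qed.

Lemma own_majority s : exists S, forall u, 0 <= lead (own true S (Some u)) s (Some u).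
Proof.
exists [set u | 0 <= lead true s (Some u)]%SET => u; rewrite /= inE.
have [//|lt0] := leP 0 (lead true s (Some u)).
by rewrite (leadN _ true) oppr_ge0 ltW.
Qed.

Let force_own n s c S :
  (forall u, 0 <= lead (own c S (Some u)) s (Some u)) ->
  (((1 - p) / (1 + C)) ^+ U) ^+ n * v (s ++ nseq n (own_outcome c S)) <= v s.
Proof.
move=> ge0; apply: forced_outcomes; first by rewrite subr_ge0.
- by move=> u; rewrite ffunE.
- by move=> u; have := ge0 u; rewrite ffunE.
- by move=> u; have := dlead_own_outcome c S (Some u); rewrite ffunE /= ffunE => ->.
Qed.

(** Here [drift S] and [drift (~: S)] are opposite and may both vanish, so the combined pot cannot
    always be captured. It is left out of [A], since combined draws have probability 0. If no urn
    favors black, the roles of the colors are exchanged to make [S] nonempty. *)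
Lemma weak_lower_bound_isolated : p = 0 ->
  exists2 theta, 0 < theta & forall s, theta <= v s.
Proof.
move=> p0; have C1 := growth_const_ge1; have p_half := p_lt_half.
pose K : R := 1 + U%:R + 2 * U%:R ^+ 2 / 1 + 4 * U%:R * C / 1.
have [J farJ] := far_exists K.
pose ka := (((1 - p) / (1 + C)) ^+ U) ^+ J.
have ka0 : 0 < ka by rewrite !exprn_gt0 // divr_gt0 //; lra.
exists (ka * 2^-1) => [|s]; first by rewrite mulr_gt0 ?invr_gt0.
have [c [S [S0 ge0]]] : exists c S, S != finset.set0 /\
    forall u, 0 <= lead (own c S (Some u)) s (Some u).
  have [S ge0] := own_majority s.
  have [S0|S0] := boolP (S != finset.set0); first by exists true, S.
  exists false, (~: S)%SET; split.
    rewrite negbK in S0; rewrite (eqP S0) finset.setC0.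
    by apply/set0Pn; exists (Ordinal U_gt0); rewrite inE.
  by move=> u; have := ge0 u; rewrite /= inE; case: ifP.
apply: le_trans (force_own J ge0); rewrite ler_pM2l //.
set A := (~: [set None])%SET : {set pot U}.
have indA u : Some u \in A by rewrite !inE.
have leads i : i \in A -> J%:R <= lead (own c S i) (s ++ nseq J (own_outcome c S)) i.
  rewrite !inE; case: i => [u _|//].
  by rewrite lead_cat_nseq dlead_own_outcome mulr1 lerDr ge0.
have [safe_s risk_s] := risk_far ltr01 (lexx _) farJ leads.
apply: (v_rule (c := c) S0) => n.
apply: le_trans (_ : 1 - risk A (own c S) K (s ++ nseq J (own_outcome c S)) <= _).
  lra.
apply: (surv_ge (own_step_le1 S) ltr01 _ (lexx _) _ n _ safe_s).
- by case=> [u _|]; [rewrite mean_own_step; lra|rewrite !inE].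
- by move=> o i; exact: own_step_dlead.
move=> s' o kern0 nbad; apply/forallP => u.
have x : ~~ (o u).1.
  apply: contraNN kern0 => x; rewrite /kern (bigD1 u) //= /kern1 x p0 !mul0r //.
by rewrite (negPf x) /= (bad_own indA nbad x).
Qed.

Lemma weak_lower_bound_linked : 0 < p ->
  exists2 theta, 0 < theta & forall s, theta <= v s.
Proof.
move=> p_gt0; have C1 := growth_const_ge1; have p_half := p_lt_half.
(* The least positive drift over all sets, capped by the drift of a single urn: one [K] then fits
   every profile. *)
pose m := \big[Num.min/1 - 2 * p]_(S | 0 < drift S) drift S.
have m0 : 0 < m by apply: lt_bigmin => //; lra.
have m_le : m <= 1 - 2 * p by apply: bigmin_le_id.
have m_drift S : 0 < drift S -> m <= drift S by move=> h; apply: bigmin_le_cond.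
pose K : R := 1 + U%:R + 2 * U%:R ^+ 2 / m + 4 * U%:R * C / m.
have [J farJ] := far_exists K.
have [K1 _ _ _] := K_facts m0 (lexx K).
have U1 : 1 <= U%:R :> R by rewrite ler1n.
pose ka := ((p / (1 + C)) ^+ U) ^+ J.
pose kb := (((1 - p) / (1 + C)) ^+ U) ^+ (J + J).
have ka0 : 0 < ka by rewrite !exprn_gt0 // divr_gt0 //; lra.
have kb0 : 0 < kb by rewrite !exprn_gt0 // divr_gt0 //; lra.
have captured c S s : 0 < drift S -> (forall i, J%:R <= lead (own c S i) s i) -> 2^-1 <= v s.
  move=> dS leads.
  have S0 : S != finset.set0 by apply: contraTneq dS => ->; rewrite -leNgt drift_set0.
  have [safe_s risk_s] := @risk_far [set: pot U]%SET (own c S) m K J s m0 (lexx _) farJ (fun i _ => leads i).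
  apply: (v_rule (c := c) S0) => n.
  apply: le_trans (_ : 1 - risk [set: pot U]%SET (own c S) K s <= _); first by lra.
  apply: (surv_ge (own_step_le1 S) m0 _ (lexx _) _ n _ safe_s).
  - by move=> i _; rewrite mean_own_step; case: i => [u|] //; exact: m_drift.
  - by move=> o i; apply: own_step_dlead => u; rewrite inE.
  move=> s' o _ nbad; apply/forallP => u.
  move: nbad; rewrite negb_exists => /forallP/(_ u); rewrite inE /=.
  by case: (o u).1 => /negPn.
(* [J] forced combined draws of [c] bring the combined lead to [J] and cost each urn at most [J];
   hence the margin [J + J]. *)
have central c S s : 0 < drift S -> 0 <= lead c s None ->
    (forall u, (J + J)%:R <= lead (own c S (Some u)) s (Some u)) -> ka * 2^-1 <= v s.
  move=> dS ge0 leads.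
  apply: le_trans (_ : ka * v (s ++ nseq J (all_outcome c)) <= _); last first.
    have dl : 0 <= dlead c (all_outcome c) None :> R by rewrite dlead_all_outcome.
    by apply: forced_outcomes => // u; rewrite ffunE.
  rewrite ler_pM2l //; apply: (captured c S) => // -[u|].
    rewrite lead_cat_nseq.
    have : -1 <= dlead (own c S (Some u)) (all_outcome c) (Some u) :> R.
      by rewrite /= /sgc; case: ifP; lra.
    move=> /(ler_wpM2l (ler0n R J)); have := leads u; rewrite natrD; lra.
  rewrite lead_cat_nseq (dlead_all_outcome c None) -[leLHS]add0r lerD //.
  by rewrite ler_peMr.
have after_own c S s : (forall u, 0 <= lead (own c S (Some u)) s (Some u)) ->
    forall u, (J + J)%:R <=
      lead (own c S (Some u)) (s ++ nseq (J + J) (own_outcome c S)) (Some u).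
  by move=> ge0 u; rewrite lead_cat_nseq dlead_own_outcome mulr1 lerDr ge0.
pose theta := kb * (ka * 2^-1).
have theta0 : 0 < theta by rewrite !mulr_gt0 ?invr_gt0.
(* Forced draws from the single urns restore their leads to [J + J]; since [excess S >= 0], they do
   not lower the combined lead. *)
have restart c S s : 0 < drift S -> 0 <= excess S -> 0 <= lead c s None ->
    (forall u, 0 <= lead (own c S (Some u)) s (Some u)) -> theta <= v s.
  move=> dS eS ge0 leads.
  apply: le_trans (force_own (J + J) leads); rewrite ler_pM2l //.
  apply: (central c S) => //; last exact: after_own.
  rewrite lead_cat_nseq addr_ge0 // (dlead_own_outcome c S None) mulr_ge0 //.
(* Here [c] may be behind in the combined pot. Even with all combined draws counted against [c], its
   combined lead has mean increment [- drift (~: S) >= 0], so [reach] applies with [restart] as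
   target. *)
have climb c S s : 0 < drift S -> drift (~: S)%SET <= 0 ->
    (forall u, (J + J)%:R <= lead (own c S (Some u)) s (Some u)) -> theta * 8^-1 <= v s.
  move=> dS dSC leads.
  set A := (~: [set None])%SET : {set pot U}.
  have indA u : Some u \in A by rewrite !inE.
  have eS : 0 <= excess S.
    move: dSC; rewrite /drift excessC mulrN subr_le0 => h.
    have : 0 <= (1 - p) * excess S by apply: le_trans h; rewrite mulr_ge0.
    by rewrite pmulr_rge0 //; lra.
  have [safe_s risk_s] : safe A (own c S) K s /\ risk A (own c S) K s <= 8^-1.
    apply: (risk_far m0 (lexx _) farJ) => -[u _|]; last by rewrite !inE.
    by apply: le_trans (leads u); rewrite ler_nat leq_addr.
  apply: le_trans (_ : theta * (4^-1 - risk A (own c S) K s) <= _).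
    by rewrite ler_pM2l //; lra.
  pose sw u x : R := if x then -1 else if u \in S then 1 else -1.
  apply: (@reach A (own c S) (own_step S) m K (own_step_le1 S) m0 _ (lexx _) _
    c None sw (p ^+ U)) => //.
  - by case=> [u _|]; [rewrite mean_own_step|rewrite !inE].
  - by move=> o i; exact: own_step_dlead.
  - by move=> u x; rewrite /sw; case: ifP; [|case: ifP]; rewrite ?normrN normr1.
  - move=> o nbad; apply: ler_sum => u _; rewrite /sw /sgc; case: ifP => x; first by case: ifP; lra.
    rewrite (bad_own indA nbad (negbT x)); case: ifP => uS; first by rewrite eqxx.
    by case: ifP; lra.
  - have -> : mean p sw = - drift (~: S)%SET.
      rewrite /drift excessC mulrN opprB /mean /sw big_split /= addrC; congr (_ + _).
        by rewrite -mulr_sumr.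
      by rewrite sumr_const card_ord -[LHS]mulr_natr; ring.
    by rewrite oppr_ge0.
  - exact: exprn_gt0.
  - move=> s'.
    (* With probability [p ^+ U] all draws are combined, and then [total_step sw] is [- U]: this
       bounds the second moment below. *)
    have <- : \sum_o kern s' o * \prod_(u < U) ((o u).1)%:R = p ^+ U.
      rewrite (sum_kern_prod _ _ _ (fun _ e => (e.1)%:R)).
      rewrite (eq_bigr (fun=> p)) ?prodr_const ?card_ord // => u _.
      by rewrite (sum_kern1_x p w_gt0 s' u (fun x => x%:R)) /= mulr1n mulr0n; ring.
    apply: ler_sum => o _; rewrite ler_wpM2l ?kern_ge0 //.
    have [allx|] := boolP [forall u, (o u).1]; last first.
      rewrite negb_forall => /existsP[u /negPf x].
      by rewrite (bigD1 u) //= x mul0r sqr_ge0.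
    rewrite big1 => [|u _]; last by rewrite (forallP allx).
    have -> : total_step sw o = - U%:R.
      rewrite /total_step (eq_bigr (fun=> -1)) => [|u _]; last by rewrite /sw (forallP allx).
      by rewrite sumrN sumr_const card_ord.
    by rewrite sqrrN exprn_ege1.
  move=> s' safe_s' ge0; apply: (restart c S) => // u.
  by apply: le_trans (safe_s' (Some u) (indA u)); lra.
exists (kb * (theta * 8^-1)) => [|s]; first by rewrite !mulr_gt0 ?invr_gt0.
have [S ge0] := own_majority s.
apply: le_trans (force_own (J + J) ge0); rewrite ler_pM2l //.
move: (after_own _ _ _ ge0); set s1 := s ++ _ => leads.
have leadsC u : (J + J)%:R <= lead (own false (~: S)%SET (Some u)) s1 (Some u).
  by have := leads u; rewrite /= inE; case: ifP.
have leads_c c : exists T, forall u, (J + J)%:R <= lead (own c T (Some u)) s1 (Some u).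
  by case: c; [exists S|exists (~: S)%SET].
have theta_le : theta * 8^-1 <= ka * 2^-1.
  have kb1 : kb <= 1.
    rewrite /kb -exprM exprn_ile1 ?divr_ge0 //; try lra.
    by rewrite ler_pdivrMr; lra.
  apply: le_trans (_ : 1 * (ka * 2^-1) * 1 <= _); last by rewrite mul1r mulr1.
  by rewrite ler_pM ?ler_pM ?mulr_ge0 //; lra.
have [c ge0c] : exists c, 0 <= lead c s1 None.
  by have [|] := leP 0 (lead true s1 None); [exists true|exists false; rewrite (leadN _ true) oppr_ge0 ltW].
have [T leadsT] := leads_c c.
have [dT|dT] := ltP 0 (drift T).
  by apply: le_trans theta_le _; apply: (central c T).
(* As [drift T <= 0], [driftC] gives the complement positive drift: the other color climbs back. *)
apply: (climb (~~ c) (~: T)%SET); rewrite ?finset.setCK //.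
  have := driftC T; have : 0 < 2 * p * U%:R by rewrite !mulr_gt0 //; lra.
  lra.
by move=> u; have := leadsT u; rewrite /= inE negbK; case: ifP.
Qed.

Lemma weak_lower_bound : exists2 theta, 0 < theta & forall s, theta <= v s.
Proof.
have [p0|p0] := eqVneq p 0; first exact: weak_lower_bound_isolated.
by apply: weak_lower_bound_linked; rewrite lt_neqAle eq_sym p0.
Qed.

End weak.

End drift.

(** * Growth of the weights *)

Section weights.
Context (R : realType) (w : nat -> R).
Hypothesis w_gt0 : forall i, 0 < w i.

Lemma ratio_ge_of_liminf : (1 < limn_einf (fun i => (w i.+1 / w i)%:E))%E ->
  exists2 rho : R, 1 < rho & exists N, forall n, (N <= n)%N -> rho * w n <= w n.+1.
Proof.
rewrite limn_einf_lim (cvg_lim _ (@cvg_einfs_sup _ _)) //.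
move=> /ereal_sup_gt[_ [N _ <-]].
set u := fun i => _; have le_u n : (N <= n)%N -> (einfs u N <= u n)%E.
  by move=> Nn; apply: ereal_inf_lbound; exists n.
case E : (einfs u N) => [rho| |]; last by [].
- rewrite lte_fin => rho1; exists rho => //; exists N => n /le_u.
  by rewrite E lee_fin ler_pdivlMr.
- by have := le_u N (leqnn N); rewrite E leye_eq.
Qed.

(** Take [e <= 1] with [7e <= rho - 1], so that [(1 + e)^3 <= 1 + 7e <= rho], and cube the linear
    lower bound [e * k.+1 <= (1 + e) ^+ k]. *)
Lemma exp_dominates_cube (rho : R) : 1 < rho ->
  exists2 C1 : R, 0 < C1 & forall k, (k.+1)%:R ^+ 3 <= C1 * rho ^+ k.
Proof.
move=> rho1; pose e := Num.min 1 ((rho - 1) / 7).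
have e0 : 0 < e by rewrite lt_min ltr01 divr_gt0 // subr_gt0.
have e1 : e <= 1 by rewrite ge_min lexx.
have e7 : 7 * e <= rho - 1.
  by rewrite mulrC -ler_pdivlMr // ge_min lexx orbT.
have cube : (1 + e) ^+ 3 <= rho.
  have : e * e <= e * 1 by rewrite ler_pM2l.
  have : e * e * e <= e * 1 * 1 by rewrite !ler_pM ?mulr_ge0 // ltW.
  by rewrite !exprS expr0; nra.
have bern k : e * k.+1%:R <= (1 + e) ^+ k.
  elim: k => [|k IHk]; first by rewrite mulr1.
  rewrite exprS mulrDl mul1r -addn1 natrD mulrDr mulr1 lerD //.
  rewrite -[leLHS]mulr1 ler_pM2l // exprn_ege1 //; lra.
exists (e ^- 3) => [|k]; first by rewrite invr_gt0 exprn_gt0.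
rewrite mulrC ler_pdivlMr ?exprn_gt0 // -exprMn mulrC.
apply: le_trans (_ : ((1 + e) ^+ k) ^+ 3 <= _).
  by rewrite lerXn2r ?nnegrE ?mulr_ge0 ?exprn_ge0 //; lra.
rewrite -exprM mulnC exprM lerXn2r ?nnegrE ?exprn_ge0 //; lra.
Qed.

Lemma growth_of_ratio (rho : R) N : 1 < rho ->
  (forall n, (N <= n)%N -> rho * w n <= w n.+1) ->
  exists C, forall i j, (j <= i)%N -> w j * (i - j).+1%:R ^+ 3 <= C * w i.
Proof.
move=> rho1 ratio; have [C1 C1_gt0 cube] := exp_dominates_cube rho1.
have rho0 : 0 < rho := lt_trans ltr01 rho1.
pose b i := w i / rho ^+ i.
have b0 i : 0 < b i by rewrite divr_gt0 // exprn_gt0.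
have bS n : (N <= n)%N -> b n <= b n.+1.
  move=> /ratio h; rewrite /b exprS invfM mulrA ler_pM2r ?invr_gt0 ?exprn_gt0 //.
  by rewrite ler_pdivlMr // mulrC.
have b_mono i j : (N <= j)%N -> (j <= i)%N -> b j <= b i.
  move=> Nj; elim: i => [|i IHi]; first by rewrite leqn0 => /eqP ->.
  rewrite leq_eqVlt => /predU1P[-> //|ji]; apply: le_trans (IHi ji) (bS _ _).
  exact: leq_trans Nj ji.
(* The normalized weights [b] increase only from [N] on. [M] bounds the earlier ones and [M'] bounds
   the inverse of all of them, so [b j <= M * M' * b i] for all [j <= i]. *)
pose M := \sum_(i < N.+1) b i; pose M' := \sum_(i < N.+1) (b i)^-1.
have le_M i : (i <= N)%N -> b i <= M.
  by rewrite -ltnS => iN; rewrite /M (bigD1 (Ordinal iN)) //= lerDl sumr_ge0 // => k _; exact: ltW.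
have le_M' i : 1 <= M' * b i.
  have le_N k : (k <= N)%N -> 1 <= M' * b k.
    rewrite -ltnS => kN; rewrite -ler_pdivrMr // mul1r /M' (bigD1 (Ordinal kN)) //= lerDl.
    by rewrite sumr_ge0 // => j _; rewrite invr_ge0 ltW.
  have [/le_N//|/ltnW Ni] := leqP i N.
  apply: le_trans (le_N N (leqnn N)) _; rewrite ler_wpM2l ?b_mono //.
  by rewrite sumr_ge0 // => j _; rewrite invr_ge0 ltW.
have M0 : 0 < M := lt_le_trans (b0 N) (le_M N (leqnn N)).
have M'0 : 0 < M' by have := lt_le_trans ltr01 (le_M' 0); rewrite pmulr_lgt0.
have MM' : 1 <= M * M'.
  by apply: le_trans (le_M' N) _; rewrite mulrC ler_pM2r // le_M.
have le_b i j : (j <= i)%N -> b j <= M * M' * b i.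
  move=> ji; have [jN|/ltnW Nj] := leqP j N.
    by apply: le_trans (le_M j jN) _; rewrite -mulrA ler_peMr // ltW.
  by apply: le_trans (b_mono _ _ Nj ji) _; rewrite ler_peMl // ltW.
exists (M * M' * C1) => i j ji.
have wb k : w k = b k * rho ^+ k by rewrite /b divfK // gt_eqF // exprn_gt0.
apply: le_trans (_ : (M * M' * b i * rho ^+ j) * (C1 * rho ^+ (i - j)) <= _).
  apply: ler_pM; [exact: ltW|by rewrite exprn_ge0| |exact: cube].
  by rewrite wb ler_pM2r ?exprn_gt0 // le_b.
rewrite le_eqVlt; apply/orP; left; apply/eqP.
have -> : w i = b i * (rho ^+ j * rho ^+ (i - j)) by rewrite wb -exprD subnKC.
by move: (rho ^+ j) (rho ^+ (i - j)) (b i) => x y z; ring.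
Qed.

End weights.

(** * Almost sure settlement *)

Section zero_one.
Context (d : measure_display) (T : measurableType d) (R : realType).
Context (P : probability T R) (U : nat) (p : R) (w : nat -> R).
Variable xi : nat -> T -> outcome U.

Let Pr (A : set T) : R := fine (P A).

Definition traj n t : seq (outcome U) := mkseq (xi^~ t) n.

Definition cyl (s : seq (outcome U)) : set T := [set t | traj (size s) t = s].

Hypothesis measurable_cyl : forall s, measurable (cyl s).

Let PrE A : measurable A -> P A = (Pr A)%:E.
Proof. by move=> mA; rewrite fineK // fin_num_measure. Qed.

Let Pr_ge0 A : 0 <= Pr A. Proof. exact: fine_ge0. Qed.

Let Pr_le A B : measurable A -> measurable B -> A `<=` B -> Pr A <= Pr B.
Proof. by move=> mA mB AB; rewrite -lee_fin -!PrE // le_measure ?inE. Qed.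

Let PrU A B : measurable A -> measurable B -> A `&` B = set0 ->
  Pr (A `|` B) = Pr A + Pr B.
Proof.
move=> mA mB AB; apply: EFin_inj.
by rewrite EFinD -!PrE ?measureU //; exact: measurableU.
Qed.

Let PrC A : measurable A -> Pr (~` A) = 1 - Pr A.
Proof.
move=> mA; apply: EFin_inj; rewrite EFinB -!PrE //; last exact: measurableC.
exact: probability_setC.
Qed.

Let PrIC A B : measurable A -> measurable B -> Pr A = Pr (A `&` B) + Pr (A `&` ~` B).
Proof.
move=> mA mB; have mC := measurableC mB.
rewrite -PrU; [|exact: measurableI|exact: measurableI|].
  by rewrite -setIUr setUv setIT.
by rewrite setIACA setICr setI0.
Qed.

Lemma measurable_traj n (h : pred (seq (outcome U))) :
  measurable [set t | h (traj n t)].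
Proof.
have -> : [set t | h (traj n t)] =
    \bigcup_s (if (size s == n) && h s then cyl s else set0).
  apply/seteqP; split=> [t /= ht|t [s _]].
    by exists (traj n t) => //; rewrite size_mkseq eqxx ht /cyl /= size_mkseq.
  by case: ifP => // /andP[/eqP <- hs] /= ->.
apply: countable_bigcupT_measurable => [|s]; first exact: countableP.
by case: ifP => _; [exact: measurable_cyl|exact: measurable0].
Qed.

Lemma measurable_xi n o : measurable [set t | xi n t = o].
Proof.
have -> : [set t | xi n t = o] = [set t | nth o (traj n.+1 t) n == o].
  apply/seteqP; split=> t /=; rewrite nth_mkseq ?ltnSn //; first by move=> ->.
  by move/eqP.
exact: (measurable_traj n.+1 (fun s => nth o s n == o)).
Qed.

Lemma cyl_rcons s o : cyl (rcons s o) = cyl s `&` [set t | xi (size s) t = o].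
Proof.
rewrite /cyl size_rcons; apply/seteqP; split=> t; rewrite /traj /= mkseqS.
  by move/rcons_inj => [].
by move=> [-> ->].
Qed.

Let measurable_fiber A n o : measurable A -> measurable (A `&` [set t | xi n t = o]).
Proof. by move=> mA; apply: measurableI => //; exact: measurable_xi. Qed.

Let Pr0 : Pr set0 = 0. Proof. by rewrite /Pr measure0. Qed.

Let Pr_outcome A n : measurable A ->
  Pr A = \sum_o Pr (A `&` [set t | xi n t = o]).
Proof.
move=> mA.
have part (r : seq (outcome U)) : uniq r ->
    measurable (A `&` [set t | xi n t \in r]) /\
    Pr (A `&` [set t | xi n t \in r]) = \sum_(o <- r) Pr (A `&` [set t | xi n t = o]).
  elim: r => [_|o r IHr /= /andP[or /IHr[mr IH]]].
    have -> : A `&` [set t | xi n t \in [::]] = set0 by apply/seteqP; split=> t // [].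
    by rewrite big_nil Pr0.
  have -> : A `&` [set t | xi n t \in o :: r] =
      (A `&` [set t | xi n t = o]) `|` (A `&` [set t | xi n t \in r]).
    apply/seteqP; split=> t /=; rewrite inE.
      by move=> [At /orP[/eqP|]]; [left|right].
    by move=> [[At ->]|[At ->]]; rewrite ?eqxx ?orbT.
  split; first by apply: measurableU => //; exact: measurable_fiber.
  rewrite big_cons PrU ?IH //; first exact: measurable_fiber.
  by apply/seteqP; split=> t // [[_ /= ->] [_ /= /(negP or)]].
have [_] := part (index_enum (outcome U)) (index_enum_uniq _).
by congr (Pr _ = _); apply/seteqP; split=> t /=; [case|rewrite mem_index_enum].
Qed.

Variables (J : finType) (ok : J -> pred (outcome U)).

(** The index [j] may depend on the window, which keeps each event decided by finitely many
    outcomes; [settlesP] recovers a single [j]. *)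
Definition obeys n K : set T :=
  [set t | [exists j, all (ok j) (drop n (traj K t))]].

Definition settles : set T := \bigcup_n \bigcap_K obeys n K.

Lemma measurable_obeys n K : measurable (obeys n K).
Proof. exact: (measurable_traj K (fun s => [exists j, all (ok j) (drop n s)])). Qed.

Lemma measurable_settles : measurable settles.
Proof.
by apply: bigcupT_measurable => n; apply: bigcapT_measurable => K; exact: measurable_obeys.
Qed.

Lemma all_drop_traj (j : J) n K t :
  reflect (forall k, (n <= k < K)%N -> ok j (xi k t)) (all (ok j) (drop n (traj K t))).
Proof.
apply: (iffP (all_nthP (xi 0 t))) => h k.
  move=> /andP[nk kK].
  have /h : (k - n < size (drop n (traj K t)))%N by rewrite size_drop size_mkseq; lia.
  by rewrite nth_drop subnKC // nth_mkseq.
rewrite size_drop size_mkseq nth_drop => kK; rewrite nth_mkseq ?h ?leq_addr //=; lia.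
Qed.

(** Compactness of the finite type [J]: if every index failed at some time, the window ending after
    the last of these failures would obey no index. *)
Lemma settlesP t : settles t -> exists (j : J) n0, forall k, (n0 <= k)%N -> ok j (xi k t).
Proof.
move=> [n _ ob]; apply: contrapT => /forallNP h.
have viol j : exists k, (n <= k)%N /\ ~~ ok j (xi k t).
  apply: contrapT => /forallNP hj; apply: (h j); exists n => k nk.
  by apply/negPn/negP => nok; apply: (hj k).
have [k_ hk] := choice viol.
have /existsP[j /all_drop_traj allj] := ob (\max_j k_ j).+1 I.
have [nk nok] := hk j; move: nok; rewrite allj // nk ltnS.
exact: (leq_bigmax j).
Qed.

(* The value 1 on null cylinders keeps [settle_prob] superharmonic there. *)
Definition settle_prob s : R :=
  if Pr (cyl s) == 0 then 1 else Pr (settles `&` cyl s) / Pr (cyl s).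

Lemma settle_prob_ge0 s : 0 <= settle_prob s.
Proof. by rewrite /settle_prob; case: ifP => // _; rewrite divr_ge0. Qed.

Let mF := measurable_settles.

Let settle_probM s : settle_prob s * Pr (cyl s) = Pr (settles `&` cyl s).
Proof.
rewrite /settle_prob; case: ifPn => [/eqP E|n0]; last by rewrite divfK.
rewrite E mulr0; apply/esym/eqP; rewrite eq_le Pr_ge0 andbT -E.
by apply: Pr_le => //; exact: measurableI.
Qed.

Lemma settle_prob_le1 s : settle_prob s <= 1.
Proof.
rewrite /settle_prob; case: ifPn => // n0.
rewrite ler_pdivrMr ?mul1r; last by rewrite lt_neqAle eq_sym n0 Pr_ge0.
by apply: Pr_le => //; exact: measurableI.
Qed.

Let Pr_cap (F : nat -> set T) : (forall n, measurable (F n)) ->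
  {homo F : m n / (m <= n)%N >-> n `<=` m} -> Pr (F n) @[n --> \oo] --> Pr (\bigcap_n F n).
Proof.
move=> mF' ndF; have mcap : measurable (\bigcap_n F n) by exact: bigcapT_measurable.
apply: fine_cvg; rewrite -PrE //; apply: nonincreasing_cvg_mu => //.
  by rewrite ltey_eq fin_num_measure.
by move=> m n /ndF h; apply/subsetPset.
Qed.

Section lower_bound.
Variable theta : R.
Hypothesis theta_gt0 : 0 < theta.
Hypothesis theta_le : forall s, theta <= settle_prob s.

(** Extends the bound from cylinders to events decided by [k] further outcomes, splitting on the
    next outcome until the event is a cylinder or empty. *)
Let Pr_settles_ge k s (h : pred (seq (outcome U))) :
  theta * Pr (cyl s `&` [set t | h (traj (size s + k) t)]) <=
  Pr (settles `&` (cyl s `&` [set t | h (traj (size s + k) t)])).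
Proof.
elim: k s => [|k IHk] s.
  have [hs|nhs] := boolP (h s).
    have -> : cyl s `&` [set t | h (traj (size s + 0) t)] = cyl s.
      by apply/seteqP; split=> t; [case|move=> st; split=> //=; rewrite addn0 st].
    by rewrite -settle_probM ler_wpM2r.
  have -> : cyl s `&` [set t | h (traj (size s + 0) t)] = set0.
    by apply/seteqP; split=> t // -[st /=]; rewrite addn0 st (negPf nhs).
  by rewrite setI0 Pr0 mulr0.
have mH := measurableI _ _ (measurable_cyl s) (measurable_traj (size s + k.+1) h).
rewrite (Pr_outcome (size s) mH) (Pr_outcome (size s) (measurableI _ _ mF mH)) mulr_sumr.
apply: ler_sum => o _.
rewrite -[settles `&` _ `&` _]setIA [cyl s `&` _ `&` _]setIAC -cyl_rcons.
by have := IHk (rcons s o); rewrite size_rcons addSnnS.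
Qed.

(** A finite-window event [H] approximates [settles]. Outside [H], [settles] has probability at most
    [e], but also at least [theta] times that of the complement of [H], which is nearly
    [1 - Pr settles]. *)
Lemma settles_ae : {ae P, forall t, settles t}.
Proof.
suff F1 : Pr settles = 1.
  exists (~` settles); split => //; first exact: measurableC.
  by rewrite PrE; [rewrite PrC // F1 subrr|exact: measurableC].
pose G n := \bigcap_K obeys n K.
have mG n : measurable (G n) by apply: bigcapT_measurable => K; exact: measurable_obeys.
have G_cvg : Pr (G n) @[n --> \oo] --> Pr settles.
  apply: fine_cvg; rewrite -PrE //; apply: nondecreasing_cvg_mu => // m n mn; apply/subsetPset => t h K _.
  have /existsP[j /all_drop_traj hj] := h K I; apply/existsP; exists j.
  by apply/all_drop_traj => k /andP[k1 k2]; apply: hj; rewrite k2 (leq_trans mn).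
have F_le1 : Pr settles <= 1 by rewrite -subr_ge0 -PrC.
apply/eqP; rewrite eq_le F_le1 /=; rewrite leNgt; apply/negP => F_lt1.
(* With this [e] the estimates combine into [4e <= e + theta * e <= 2e], a contradiction. *)
pose e := theta * (1 - Pr settles) / 4.
have e0 : 0 < e by rewrite divr_gt0 // mulr_gt0 // subr_gt0.
have [n Gn] : exists n, Pr settles - e < Pr (G n).
  have lt : Pr settles - e < Pr settles by rewrite ltrBlDr ltrDl.
  by have [n _ hn] := cvgr_gt _ G_cvg _ lt; exists n; exact: hn (leqnn n).
have [K HK] : exists K, Pr (obeys n K) < Pr (G n) + e.
  have cv : Pr (obeys n K) @[K --> \oo] --> Pr (G n).
    apply: Pr_cap => [K|K K' KK' t /existsP[j /all_drop_traj hj]]; first exact: measurable_obeys.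
    apply/existsP; exists j; apply/all_drop_traj => k /andP[k1 k2].
    by apply: hj; rewrite k1 (leq_trans k2).
  have lt : Pr (G n) < Pr (G n) + e by rewrite ltrDl.
  by have [K _ hK] := cvgr_lt _ cv _ lt; exists K; exact: hK (leqnn K).
set H := obeys n K in HK; have mH : measurable H by exact: measurable_obeys.
have GF : Pr (G n) <= Pr (settles `&` H).
  by apply: (Pr_le (mG n) (measurableI _ _ mF mH)) => t Gt; split; [exists n|exact: Gt].
have GFle : Pr (G n) <= Pr settles by apply: Pr_le => // t Gt; exists n.
have F_split := PrIC mF mH.
have low := Pr_settles_ge K [::] (fun s => ~~ [exists j, all (ok j) (drop n s)]).
have cyl0 : cyl [::] = setT by apply/seteqP; split.
rewrite cyl0 setTI add0n in low.
have HC : [set t | ~~ [exists j, all (ok j) (drop n (traj K t))]] = ~` H.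
  by apply/seteqP; split=> t /= /negP.
move: low; rewrite HC PrC // => low.
have : theta * (1 - Pr H) <= e by lra.
have : theta * (1 - Pr settles) = 4 * e by rewrite /e; field.
have theta1 : theta <= 1 := le_trans (theta_le [::]) (settle_prob_le1 _).
have : theta * Pr H <= theta * (Pr settles + e) by rewrite ler_pM2l //; lra.
have : theta * e <= 1 * e by rewrite ler_pM2r.
lra.
Qed.

End lower_bound.

Hypotheses (p_ge0 : 0 <= p) (p_le1 : p <= 1).
Hypothesis w_gt0 : forall i, 0 < w i.
Hypothesis Pr_cyl_rcons : forall s o, Pr (cyl (rcons s o)) = Pr (cyl s) * kern p w s o.

Lemma settle_prob_super s :
  \sum_o kern p w s o * settle_prob (rcons s o) <= settle_prob s.
Proof.
have [E|n0] := eqVneq (Pr (cyl s)) 0.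
  rewrite {2}/settle_prob E eqxx -(sum_kern p w_gt0 s).
  by apply: ler_sum => o _; rewrite ler_piMr ?kern_ge0 // settle_prob_le1.
have s_gt0 : 0 < Pr (cyl s) by rewrite lt_neqAle eq_sym n0 Pr_ge0.
rewrite -(ler_pM2r s_gt0) settle_probM mulr_suml.
rewrite (Pr_outcome (size s) (measurableI _ _ mF (measurable_cyl s))).
apply: ler_sum => o _; rewrite -setIA -cyl_rcons -settle_probM Pr_cyl_rcons.
by rewrite le_eqVlt; apply/orP; left; apply/eqP; ring.
Qed.

Definition obeying_cyl (j : J) n s : set T :=
  cyl s `&` [set t | all (ok j) (drop (size s) (traj (size s + n) t))].

Let measurable_obeying_cyl j n s : measurable (obeying_cyl j n s).
Proof.
apply: measurableI => //.
exact: (measurable_traj (size s + n) (fun s' => all (ok j) (drop (size s) s'))).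
Qed.

Lemma Pr_obeying_cyl j n s :
  Pr (obeying_cyl j n s) = Pr (cyl s) * surv p w (ok j) n s.
Proof.
elim: n s => [|n IHn] s.
  rewrite mulr1; congr Pr; apply/seteqP; split=> t; first by case.
  move=> st; split=> //=; rewrite addn0 drop_oversize // size_mkseq //.
rewrite (Pr_outcome (size s)) //= mulr_sumr; apply: eq_bigr => o _.
have [oko|nok] /= := boolP (ok j o); last first.
  rewrite mul0r !mulr0 -Pr0; congr Pr; apply/seteqP; split=> t //.
  move=> [[_ /= /all_drop_traj h] xo]; move: (h (size s)).
  rewrite xo (negPf nok) leqnn addnS ltnS leq_addr; by move=> /(_ isT).
rewrite mul1r mulrA -Pr_cyl_rcons -IHn; congr Pr.
rewrite /obeying_cyl cyl_rcons size_rcons addSnnS; apply/seteqP; split=> t.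
  move=> [[st /= /all_drop_traj h] xo]; split=> //=; apply/all_drop_traj => k /andP[k1 k2].
  by apply: h; rewrite k2 (ltnW k1).
move=> [[st xo] /= /all_drop_traj h]; split=> //; split=> //=; apply/all_drop_traj => k /andP[k1 k2].
by move: k1; rewrite leq_eqVlt => /predU1P[<-|k1]; [rewrite xo|apply: h; rewrite k1].
Qed.

(** Obeying [j] forever after [s] implies settling, and its probability is the limit of those of the
    decreasing events [obeying_cyl]. *)
Lemma settle_prob_surv j s r :
  (forall n, r <= surv p w (ok j) n s) -> r <= settle_prob s.
Proof.
move=> le_r; have [E|n0] := eqVneq (Pr (cyl s)) 0.
  (* On a null cylinder the value 1 equals [surv] at [n = 0]. *)
  by rewrite /settle_prob E eqxx; exact: (le_r 0).
have s_gt0 : 0 < Pr (cyl s) by rewrite lt_neqAle eq_sym n0 Pr_ge0.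
rewrite -(ler_pM2r s_gt0) settle_probM.
have mcap : measurable (\bigcap_n obeying_cyl j n s) by exact: bigcapT_measurable.
apply: le_trans (_ : Pr (\bigcap_n obeying_cyl j n s) <= _).
  have cv := @Pr_cap (fun n => obeying_cyl j n s) (fun n => measurable_obeying_cyl j n s).
  apply: (cvgr_to_ge (cv _)).
    move=> m n mn t [st /= /all_drop_traj h]; split=> //=; apply/all_drop_traj => k /andP[k1 k2].
    by apply: h; rewrite k1 (leq_trans k2) // leq_add2l.
  apply: nearW => n; rewrite Pr_obeying_cyl mulrC ler_pM2l //.
apply: Pr_le => //; first exact: measurableI.
move=> t h; split; last by case: (h 0 I).
exists (size s) => // K _; apply/existsP; exists j; apply/all_drop_traj => k /andP[k1 k2].
have [_ /= /all_drop_traj] := h K I; apply; rewrite k1 (leq_trans k2) // leq_addl //.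
Qed.

End zero_one.

(** * Law of the mechanism *)

Section law.
Context (d : measure_display) (T : measurableType d) (R : realType).
Context (P : probability T R) (U : nat) (p : R) (w : nat -> R).
Variables X V : nat -> 'I_U -> {RV P >-> R}.
Hypothesis w_gt0 : forall i, 0 < w i.
Hypothesis X_law : forall n u, (1 <= n)%N -> P [set t | X n u t = 1] = p%:E.
Hypothesis V_law : forall n u (A : set R), (1 <= n)%N -> measurable A ->
  distribution P (V n u) A = uniform_prob (@ltr01 R) A.

Let D : set (nat * 'I_U) := [set nu | (1 <= nu.1)%N].

Hypothesis X_indep : mutually_independent D (fun nu => X nu.1 nu.2).
Hypothesis V_indep : mutually_independent D (fun nu => V nu.1 nu.2).
Hypothesis XV_indep : independent_families D D
  (fun nu => X nu.1 nu.2) (fun nu => V nu.1 nu.2).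

(** Outcomes are indexed from 0: outcome [n] describes the ball added at time [n.+1]. *)
Definition step_outcome (n : nat) (t : T) : outcome U :=
  [ffun u => (X n.+1 u t == 1,
     ball_added w (fun n u => X n u t) (fun n u => V n u t) n.+1 u)].

Let blk t := blacks w (fun n u => X n u t) (fun n u => V n u t).

Lemma blacks_content n t u :
  blk t n u = content true (traj step_outcome n t) (Some u) /\
  (n - blk t n u)%N = content false (traj step_outcome n t) (Some u).
Proof.
rewrite /content; elim: n => [//|n [IHb IHw]].
rewrite /traj mkseqS -!cats1 !count_cat /= !addn0 ffunE /= -/(traj step_outcome n t).
rewrite -IHb -IHw /blk /= -/(blk t) /ball_added /= -/(blk t).
(* Makes the truncated subtraction in the white count exact. *)
have : (blk t n u <= n)%N.
  have := count_size (fun o : outcome U => (o u).2 == true) (traj step_outcome n t).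
  by rewrite -IHb size_mkseq.
by case: (draw _ _ _ _ _ _); split; lia.
Qed.

Definition black_prob (s : seq (outcome U)) (i : pot U) : R :=
  reinf_prob w (content true s i) (content false s i).

Lemma ball_added_traj n t u :
  ball_added w (fun n u => X n u t) (fun n u => V n u t) n.+1 u =
  (V n.+1 u t < black_prob (traj step_outcome n t) (source (X n.+1 u t == 1) u)).
Proof.
rewrite /ball_added /draw /= -/(blk t) /black_prob /source.
case: ifP => _; last by have [hb hw] := blacks_content n t u; rewrite hw hb.
by congr (_ < reinf_prob _ _ _); apply: eq_bigr => k _; have [] := blacks_content n t k.
Qed.

(** The false case is the complement of 1 rather than the value -1, to match the else branch of
    [draw]. *)
Definition X_event (x : bool) : set R := if x then [set 1] else ~` [set 1].

Definition V_event (q : R) (b : bool) : set R :=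
  if b then [set y | y < q] else ~` [set y | y < q].

Lemma measurable_X_event x : measurable (X_event x).
Proof. by case: x; [|apply: measurableC]; exact: measurable_set1. Qed.

Lemma lt_itv (q : R) : [set y | y < q] = `]-oo, q[%classic.
Proof. by apply/seteqP; split=> y; rewrite /= in_itv. Qed.

Lemma measurable_V_event q b : measurable (V_event q b).
Proof.
by rewrite /V_event lt_itv; case: b; [|apply: measurableC]; exact: measurable_itv.
Qed.

Lemma P_X_event n u x : P (X n.+1 u @^-1` X_event x) = (if x then p else 1 - p)%:E.
Proof.
have mX : measurable (X n.+1 u @^-1` [set 1]).
  by rewrite -[X in measurable X]setTI; apply: measurable_funPT => //; exact: measurable_set1.
case: x; first exact: X_law.
rewrite /X_event -preimage_setC probability_setC // EFinB; congr (_ - _)%E.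
exact: X_law.
Qed.

Lemma uniform_prob_lt (q : R) : 0 <= q -> q <= 1 ->
  uniform_prob (@ltr01 R) [set y | y < q] = q%:E.
Proof.
move=> q0 q1; rewrite lt_itv.
have mI : measurable `]-oo, q[%classic by exact: measurable_itv.
have leb : lebesgue_measure (`[0, q[%classic : set R) = q%:E.
  rewrite lebesgue_measure_itv /= lte_fin; case: ltP => [_|]; first by rewrite sube0.
  by move=> q0'; congr EFin; apply/eqP; rewrite eq_le q0 q0'.
transitivity (\int[uniform_prob (@ltr01 R)]_x (\1_(`]-oo, q[%classic : set R) x)%:E)%E.
  by rewrite integral_indic // setIT.
rewrite integral_uniform //.
- rewrite subr0 invr1 mul1e integral_indic //.
  have -> : `]-oo, q[%classic `&` `[0%R, 1%R]%classic = `[0, q[%classic :> set R.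
    apply/seteqP; split=> y /=; rewrite !in_itv /=.
      by move=> [-> /andP[->]].
    by move=> /andP[-> yq]; split=> //; rewrite ltW // (lt_le_trans yq).
  exact: leb.
- by apply/measurable_realfun.measurable_EFinP; exact: measurable_realfun.measurable_indic.
Qed.

Lemma P_V_event n u q b : 0 <= q -> q <= 1 ->
  P (V n.+1 u @^-1` V_event q b) = (if b then q else 1 - q)%:E.
Proof.
move=> q0 q1; have mE b' := measurable_V_event q b'.
have Pt : P (V n.+1 u @^-1` V_event q true) = q%:E.
  by rewrite -(uniform_prob_lt q0 q1) -(V_law u (isT : (1 <= n.+1)%N)) //; exact: (mE true).
case: b => //.
rewrite /V_event -preimage_setC probability_setC; first by rewrite EFinB; congr (_ - _)%E.
by rewrite -[X in measurable X]setTI; apply: measurable_funPT => //; exact: (mE true).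
Qed.

Definition cyl_index n : seq (nat * 'I_U) :=
  [seq (k.+1, u) | k <- iota 0 n, u <- enum 'I_U].

Lemma cyl_indexP n nu : reflect (0 < nu.1 <= n)%N (nu \in cyl_index n).
Proof.
apply: (iffP allpairsP) => [[[k u] /= [+ _ ->]]|].
  by rewrite mem_iota.
case: nu => -[|k] u //= kn; exists (k, u) => /=; rewrite mem_iota mem_enum.
by split.
Qed.

Lemma uniq_cyl_index n : uniq (cyl_index n).
Proof.
apply: allpairs_uniq; [exact: iota_uniq|exact: enum_uniq|].
by move=> [k u] [k' u'] _ _ [-> ->].
Qed.

Section rectangle.
Variables (Z : nat -> 'I_U -> {RV P >-> R}) (B : nat * 'I_U -> set R) (n : nat).
Hypothesis mB : forall nu, measurable (B nu).

Definition rectangle : set T :=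
  \bigcap_(nu in [set` cyl_index n]) Z nu.1 nu.2 @^-1` B nu.

(** Places the event in the generated sigma-algebra, where the independence between the signs and
    the uniform variables is stated. *)
Lemma sigma_family_rectangle : sigma_family D (fun nu => Z nu.1 nu.2) rectangle.
Proof.
rewrite /sigma_family; set G := \bigcup_(_ in _) _.
have : @measurable _ (g_sigma_algebraType G) rectangle.
  apply: fin_bigcap_measurable; first exact: finite_seq.
  move=> nu /= /cyl_indexP/andP[nu0 _]; apply: sub_sigma_algebra.
  by exists nu => //; exists (B nu) => //; rewrite setTI.
by [].
Qed.

Lemma P_rectangle : mutually_independent D (fun nu => Z nu.1 nu.2) ->
  P rectangle = (\prod_(k < n) \prod_u P (Z k.+1 u @^-1` B (k.+1, u)))%E.
Proof.
move=> indep; pose A := [fset nu in cyl_index n]%fset.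
have AE : [set` A] = [set` cyl_index n].
  by apply/seteqP; split=> nu /=; rewrite inE.
rewrite /rectangle -AE indep //; last first.
  by rewrite AE => nu /= /cyl_indexP/andP[].
transitivity (\prod_(nu <- cyl_index n) P (Z nu.1 nu.2 @^-1` B nu))%E.
  apply: perm_big; apply: uniq_perm; [exact: fset_uniq|exact: uniq_cyl_index|].
  by move=> nu; rewrite inE.
rewrite /cyl_index big_allpairs_dep /=.
have -> : iota 0 n = index_iota 0 n by rewrite /index_iota subn0.
rewrite big_mkord.
by apply: eq_bigr => k _; rewrite big_enum.
Qed.

End rectangle.

Definition no_outcome : outcome U := [ffun=> (true, true)].

Let kth (s : seq (outcome U)) (nu : nat * 'I_U) := nth no_outcome s nu.1.-1 nu.2.

Let X_rect s nu := X_event (kth s nu).1.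

Let V_rect s (nu : nat * 'I_U) :=
  V_event (black_prob (take nu.1.-1 s) (source (kth s nu).1 nu.2)) (kth s nu).2.

Lemma X_eventE b x : X_event b x <-> (x == 1) = b.
Proof.
rewrite /X_event; case: b => /=; first by split=> /eqP.
by split=> [/eqP/negPf|/negbT/eqP].
Qed.

Lemma V_eventE q b y : V_event q b y <-> (y < q) = b.
Proof.
by rewrite /V_event; case: b => //=; split=> [/negP/negPf|/negbT/negP].
Qed.

Lemma step_outcomeE s o t : cyl step_outcome s t ->
  step_outcome (size s) t = o <->
  forall u, X_event (o u).1 (X (size s).+1 u t) /\
    V_event (black_prob s (source (o u).1 u)) (o u).2 (V (size s).+1 u t).
Proof.
move=> st; have E u : step_outcome (size s) t u =
   (X (size s).+1 u t == 1, V (size s).+1 u t < black_prob s (source (X (size s).+1 u t == 1) u)).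
  by rewrite ffunE ball_added_traj [traj _ _ _]st.
split=> [<- u|h].
  by rewrite E; split; [apply/X_eventE|apply/V_eventE].
apply/ffunP => u; rewrite E; have [/X_eventE -> /V_eventE ->] := h u.
by case: (o u).
Qed.

(** Once the history [s] is fixed, the thresholds compared with [V] are deterministic numbers; the
    cylinder thus splits into one condition on each [X] and one on each [V]. *)
Lemma cyl_rectangle s : cyl step_outcome s =
  rectangle X (X_rect s) (size s) `&` rectangle V (V_rect s) (size s).
Proof.
elim/last_ind: s => [|s o IHs].
  by apply/seteqP; split=> t // _.
have kth_old nu : (0 < nu.1 <= size s)%N -> kth (rcons s o) nu = kth s nu /\
    take nu.1.-1 (rcons s o) = take nu.1.-1 s.
  by case: nu => -[//|k] u /= ks; rewrite /kth nth_rcons /= ks -cats1 takel_cat // ltnW.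
have kth_new u : kth (rcons s o) ((size s).+1, u) = o u /\
    take ((size s).+1, u).1.-1 (rcons s o) = s.
  by rewrite /kth nth_rcons /= ltnn eqxx -cats1 take_size_cat.
rewrite cyl_rcons; apply/seteqP; split=> t.
  move=> [st /= /(step_outcomeE o st) h]; move: (st); rewrite IHs => -[Xst Vst].
  split=> -[k u] /= /cyl_indexP /=; rewrite size_rcons => /andP[k0]; rewrite leq_eqVlt => /predU1P[E|ks].
  - by rewrite E /X_rect; have [-> _] := kth_new u; have [] := h u.
  - rewrite /X_rect; have [|-> _] := kth_old (k, u); first by rewrite k0.
    by apply: (Xst (k, u)); apply/cyl_indexP; rewrite k0.
  - by rewrite E /V_rect; have [-> ->] := kth_new u; have [] := h u.
  - rewrite /V_rect; have [|-> ->] := kth_old (k, u); first by rewrite k0.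
    by apply: (Vst (k, u)); apply/cyl_indexP; rewrite k0.
move=> [Xst Vst]; have st : cyl step_outcome s t.
  rewrite IHs; split=> -[k u] /= /cyl_indexP /= /andP[k0 ks].
    have [|E _] := kth_old (k, u); first by rewrite k0.
    have := Xst (k, u); rewrite /X_rect E; apply.
    by apply/cyl_indexP; rewrite size_rcons k0 ltnW.
  have [|E E'] := kth_old (k, u); first by rewrite k0.
  have := Vst (k, u); rewrite /V_rect E E'; apply.
  by apply/cyl_indexP; rewrite size_rcons k0 ltnW.
split=> //=; apply/(step_outcomeE o st) => u; have [E E'] := kth_new u.
have su : ((size s).+1, u) \in cyl_index (size (rcons s o)).
  by apply/cyl_indexP; rewrite size_rcons /=.
by have := Xst _ su; have := Vst _ su; rewrite /X_rect /V_rect E E'.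
Qed.

Lemma measurable_rectangle (Z : nat -> 'I_U -> {RV P >-> R}) B n :
  (forall nu, measurable (B nu)) -> measurable (rectangle Z B n).
Proof.
move=> mB; apply: fin_bigcap_measurable => [|nu _]; first exact: finite_seq.
by rewrite -[X in measurable X]setTI; apply: measurable_funPT.
Qed.

Lemma measurable_step_cyl s : measurable (cyl step_outcome s).
Proof.
rewrite cyl_rectangle; apply: measurableI; apply: measurable_rectangle => nu.
  exact: measurable_X_event.
exact: measurable_V_event.
Qed.

Lemma P_step_cyl s :
  P (cyl step_outcome s) = (\prod_(k < size s) kern p w (take k s) (nth no_outcome s k))%:E.
Proof.
have mX nu : measurable (X_rect s nu) by exact: measurable_X_event.
have mV nu : measurable (V_rect s nu) by exact: measurable_V_event.
rewrite cyl_rectangle XV_indep; [|exact: sigma_family_rectangle|exact: sigma_family_rectangle].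
rewrite !P_rectangle // -big_split -prodEFin; apply: eq_bigr => k _.
rewrite -big_split -prodEFin; apply: eq_bigr => u _.
rewrite P_X_event P_V_event; [|exact/ltW/reinf_prob_gt0|exact: reinf_prob_le1].
rewrite /= -EFinM /kth /kern1 /black_prob /=; congr (_ * _)%:E.
(* For a white ball, [1 - q] is the reinforcement probability with the two counts exchanged. *)
case: (nth no_outcome s k u) => x [] //=.
by apply/eqP; rewrite subr_eq addrC; apply/eqP/esym/reinf_probC.
Qed.

Lemma P_step_cyl_rcons s o : fine (P (cyl step_outcome (rcons s o))) =
  fine (P (cyl step_outcome s)) * kern p w s o.
Proof.
rewrite !P_step_cyl /= size_rcons big_ord_recr /= nth_rcons ltnn eqxx.
rewrite -cats1 take_size_cat //; congr (_ * _); apply: eq_bigr => k _.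
by rewrite nth_cat ltn_ord takel_cat // ltnW.
Qed.

End law.

Theorem theorem1p2 (d : measure_display) (T : measurableType d) (R : realType)
    (P : probability T R) (U : nat) (p : R) (w : nat -> R)
    (X V : nat -> 'I_U -> {RV P >-> R})
    (U_ge1 : (1 <= U)%N)
    (p01 : 0 <= p <= 1)
    (w_gt0 : forall i, 0 < w i)
    (w_liminf : (1 < limn_einf (fun i => (w i.+1 / w i)%:E))%E)
    (X_law : forall n u, (1 <= n)%N ->
       P [set t | X n u t = 1] = p%:E /\ P [set t | X n u t = -1] = (1 - p)%:E)
    (V_law : forall n u (A : set R), (1 <= n)%N -> measurable A ->
       distribution P (V n u) A = uniform_prob (@ltr01 R) A)
    (X_indep : mutually_independent [set nu : nat * 'I_U | (1 <= nu.1)%N]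
       (fun nu => X nu.1 nu.2))
    (V_indep : mutually_independent [set nu : nat * 'I_U | (1 <= nu.1)%N]
       (fun nu => V nu.1 nu.2))
    (XV_indep : independent_families
       [set nu : nat * 'I_U | (1 <= nu.1)%N] [set nu : nat * 'I_U | (1 <= nu.1)%N]
       (fun nu => X nu.1 nu.2) (fun nu => V nu.1 nu.2)) :
  let ball (t : T) := ball_added w (fun n u => X n u t) (fun n u => V n u t) in
  (1 / 2 <= p ->
     {ae P, forall t, exists (c : color) (n0 : nat),
        forall (n : nat) (u : 'I_U), (1 <= n)%N -> (n0 <= n)%N ->
          ball t n u = c})
  /\
  (p < 1 / 2 ->
     {ae P, forall t, exists (c : color) (n0 : nat) (S : {set 'I_U}),
        S != finset.set0 /\
        (forall (u : 'I_U) (n : nat), u \in S -> (1 <= n)%N -> (n0 <= n)%N ->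
          ball t n u = c) /\
        (forall (u : 'I_U) (n : nat), u \notin S -> (1 <= n)%N -> (n0 <= n)%N ->
          (X n u t = 1 -> ball t n u = c) /\
          (X n u t = -1 -> ball t n u = ~~ c))}).
Proof.
move=> ball; have [p_ge0 p_le1] := andP p01.
have [rho rho1 [N ratio]] := ratio_ge_of_liminf w_gt0 w_liminf.
have [C w_growth] := growth_of_ratio w_gt0 rho1 ratio.
have X_law1 n u : (1 <= n)%N -> P [set t | X n u t = 1] = p%:E.
  by move=> /(X_law n u)[].
pose xi := step_outcome w X V.
have mcyl := measurable_step_cyl w X V : forall s, measurable (cyl xi s).
have Pcyl := P_step_cyl_rcons w_gt0 X_law1 V_law X_indep V_indep XV_indep.
have xi1 n t u : (xi n t u).1 = (X n.+1 u t == 1) by rewrite ffunE.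
have xi2 n t u : (xi n t u).2 = ball t n.+1 u by rewrite ffunE.
split=> hp.
  pose ok (c : bool) : pred (outcome U) := rule c [set: 'I_U]%SET.
  have [||theta theta0 theta_le] := @strong_lower_bound R U p w C p_ge0 p_le1 w_gt0
      w_growth (settle_prob P xi ok) (settle_prob_ge0 P xi ok)
      (settle_prob_super mcyl ok p_ge0 p_le1 w_gt0 Pcyl) U_ge1.
  - by move: hp; lra.
  - by move=> c s r; exact: (settle_prob_surv mcyl Pcyl (ok := ok) (j := c)).
  apply: (filterS _ (settles_ae mcyl theta0 theta_le)) => t st.
  have [c [n0 h]] := settlesP st.
  exists c, n0.+1 => -[//|n] u _ n0n.
  by have /forallP/(_ u) := h n n0n; rewrite inE orbT xi2 => /eqP.
(* Nonemptiness of [S] is packed into the finite index type, so [settlesP] returns it along with the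
   color and the set. *)
pose J := {S : bool * {set 'I_U} | S.2 != finset.set0}.
pose ok (j : J) : pred (outcome U) := rule (val j).1 (val j).2.
have [||theta theta0 theta_le] := @weak_lower_bound R U p w C p_ge0 p_le1 w_gt0
      w_growth (settle_prob P xi ok) (settle_prob_ge0 P xi ok)
      (settle_prob_super mcyl ok p_ge0 p_le1 w_gt0 Pcyl) U_ge1.
- by move: hp; lra.
- move=> c S s r S0; pose j : J := exist _ (c, S) S0.
  exact: (settle_prob_surv mcyl Pcyl (ok := ok) (j := j)).
apply: (filterS _ (settles_ae mcyl theta0 theta_le)) => t st.
have [[[c S] S0] [n0 h]] := settlesP st.
exists c, n0.+1, S; split=> //; split=> u [//|n] uS _ n0n.
  by have /forallP/(_ u) := h n n0n; rewrite /= uS orbT xi2 => /eqP.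
have /forallP/(_ u) := h n n0n; rewrite /= (negPf uS) orbF xi1 xi2 => /eqP ->.
split=> ->; first by rewrite eqxx.
by have /negPf -> : -1 != 1 :> R by rewrite eq_sym gt_eqF //; lra.
Qed.
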